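(* Let $\mathfrak{g}$ be a Lie algebra with a fixed triangular decomposition $\mathfrak{g}=\mathfrak{n}_-\oplus\mathfrak{h}\oplus\mathfrak{n}_+$ in the sense of Moody–Pianzola and set $\mathfrak{n}=\mathfrak{n}_+$. Assume that $\mu\in \mathfrak{h}^*$ is such that the Verma module $M(\mu)$ is simple. Then for any $\lambda\in (\mathfrak{n}/[\mathfrak{n},\mathfrak{n}])^*$ we have $\dim W_{\lambda}(\overline{M(\mu)})=1$; in particular, $W_{\lambda}(\overline{M(\mu)})$ is a simple $\mathfrak{n}$-module.
   Context: Everything is over $\mathbb{C}$; $\mathfrak{g}$ may be infinite dimensional, of at most countable dimension. Triangular decomposition in the sense of Moody–Pianzola: $\mathfrak{g}=\mathfrak{n}_-\oplus\mathfrak{h}\oplus\mathfrak{n}_+$ as vector spaces, where $\mathfrak{h}\ne0$ is an abelian subalgebra and $\mathfrak{n}_\pm$ are nonzero subalgebras stable under $\mathrm{ad}\,\mathfrak{h}$; $\mathfrak{n}_+$ is the direct sum of its $\mathfrak{h}$-weight spaces, with all weights in $Q_+\setminus\{0\}$, where $Q_+\subset\mathfrak{h}^*$ is the additive monoid generated by some linearly independent subset of $\mathfrak{h}^*$; and there is an involutive anti-automorphism $\sigma$ of $\mathfrak{g}$ with $\sigma(\mathfrak{n}_+)=\mathfrak{n}_-$ and $\sigma|_{\mathfrak{h}}=\mathrm{id}$. $M(\mu)=U(\mathfrak{g})\otimes_{U(\mathfrak{h}\oplus\mathfrak{n}_+)}\mathbb{C}_\mu$ is the Verma module, where $\mathbb{C}_\mu$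 is one-dimensional with $(h+x)v=\mu(h)v$ for $h\in\mathfrak{h}$, $x\in\mathfrak{n}_+$. It decomposes as $M(\mu)=\bigoplus_{\nu\in\mathfrak{h}^*}M(\mu)_\nu$ into $\mathfrak{h}$-weight spaces, and $\overline{M(\mu)}:=\prod_{\nu\in\mathfrak{h}^*}M(\mu)_\nu$ with the induced $\mathfrak{g}$-module structure. Elements of $(\mathfrak{n}/[\mathfrak{n},\mathfrak{n}])^*$ are identified with Lie algebra homomorphisms $\mathfrak{n}\to\mathbb{C}$. For a $\mathfrak{g}$-module $M$, $W_\lambda(M)=\{v\in M: xv=\lambda(x)v\text{ for all }x\in\mathfrak{n}\}$ is the $\mathfrak{n}$-submodule of Whittaker vectors of type $\lambda$.
   Formalization: The formal theorem additionally assumes that every weight space of n_+ is finite dimensional; without this the claim fails, e.g. for a Heisenberg algebra with infinitely many e_i of equal weight and λ(e_i)=1 for all i, where W_λ=0. *)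

(* Defs.v *)
From HB Require Import structures.
From mathcomp Require Import all_boot all_order all_algebra.
From mathcomp Require Import all_classical reals.
From mathcomp.real_closed Require Export complex.
From mathcomp Require Export reals.

Set Implicit Arguments.
Unset Strict Implicit.
Unset Printing Implicit Defensive.

Import GRing.Theory.
Local Open Scope classical_set_scope.
Local Open Scope ring_scope.

Section LinearAlgebra.
Context (K : fieldType) (V : lmodType K).
Implicit Types (X S : set V).

Definition subspace X := X 0 /\ forall (a : K) u v, X u -> X v -> X (a *: u + v).

Definition lin_span S : set V :=
  [set v | exists2 s : seq (K * V), (forall p, p \in s -> S p.2) &
           v = \sum_(p <- s) p.1 *: p.2].

Definition lin_indep S := forall (s : seq V) (c : V -> K),
  uniq s -> (forall v, v \in s -> S v) ->
  \sum_(v <- s) c v *: v = 0 -> forall v, v \in s -> c v = 0.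

Definition is_basis S X := lin_indep S /\ lin_span S = X.

Definition has_dim X (n : nat) :=
  exists2 S : set V, is_basis S X & (S #= `I_n)%card.

Definition finite_dim X := exists n, has_dim X n.

Definition countable_dim X := exists2 S : set V, is_basis S X & countable S.

Definition is_direct_sum (I : eqType) (Y : I -> set V) X :=
  [/\ forall i, Y i `<=` X,
      forall v, X v -> exists2 s : seq (I * V),
        (forall p, p \in s -> Y p.1 p.2) & v = \sum_(p <- s) p.2
    & forall (s : seq I) (y : I -> V), uniq s ->
        (forall i, i \in s -> Y i (y i)) -> \sum_(i <- s) y i = 0 ->
        forall i, i \in s -> y i = 0].

End LinearAlgebra.

Section Dual.
Context (K : fieldType) (V : lmodType K).

Definition dual_pred : {pred V -> K^o} := fun f => `[< linear f >].

Record dual := Dual { dual_fun :> V -> K; _ : dual_fun \in dual_pred }.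

HB.instance Definition _ := [isSub for dual_fun].
HB.instance Definition _ := [Choice of dual by <:].

Lemma dual_pred_closed : submod_closed dual_pred.
Proof.
split; first by apply/asboolP => a u v; rewrite /= scaler0 addr0.
move=> a f g /asboolP fl /asboolP gl; apply/asboolP => b u v.
have E w : (a *: f + g) w = a *: f w + g w by [].
by rewrite !E fl gl !scalerDr addrACA !scalerA mulrC.
Qed.

HB.instance Definition _ := GRing.SubChoice_isSubLmodule.Build K (V -> K^o)
  dual_pred dual (GRing.submod_closed_semi dual_pred_closed).

Lemma dual_lin (f : dual) a u v : f (a *: u + v) = a * f u + f v.
Proof. by case: f => f /= /asboolP fl; rewrite fl. Qed.

Lemma dualP (f g : dual) : (forall v, f v = g v) -> f = g.
Proof. by move=> fg; apply/val_inj/funext. Qed.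

Lemma dualDE (f g : dual) v : (f + g : dual) v = f v + g v. Proof. by []. Qed.
Lemma dualNE (f : dual) v : (- f : dual) v = - f v. Proof. by []. Qed.

End Dual.

HB.mixin Record Lmodule_isLieAlgebra (K : fieldType) g of GRing.Lmodule K g := {
  lieb : g -> g -> g;
  lieb_linl : forall a x y z, lieb (a *: x + y) z = a *: lieb x z + lieb y z;
  lieb_linr : forall a x y z, lieb z (a *: x + y) = a *: lieb z x + lieb z y;
  liebb : forall x, lieb x x = 0;
  lieb_jacobi : forall x y z,
    lieb x (lieb y z) + lieb y (lieb z x) + lieb z (lieb x y) = 0
}.
#[short(type="lieAlgType")]
HB.structure Definition LieAlgebra (K : fieldType) :=
  {g of GRing.Lmodule K g & Lmodule_isLieAlgebra K g}.

Notation "[< x , y >]" := (lieb x y) (at level 0, x, y at level 99) : ring_scope.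

HB.mixin Record Lmodule_isLieModule (K : fieldType) (g : lieAlgType K) V
    of GRing.Lmodule K V := {
  lact : g -> V -> V;
  lact_linl : forall a x y v, lact (a *: x + y) v = a *: lact x v + lact y v;
  lact_linr : forall a x u v, lact x (a *: u + v) = a *: lact x u + lact x v;
  lact_lieb : forall x y v,
    lact (lieb x y) v = lact x (lact y v) - lact y (lact x v)
}.
#[short(type="lieModType")]
HB.structure Definition LieModule (K : fieldType) (g : lieAlgType K) :=
  {V of GRing.Lmodule K V & Lmodule_isLieModule K g V}.

Section LieTheory.
Context (K : fieldType) (g : lieAlgType K).
Implicit Types x y z : g.

Lemma liebDl x y z : [< x + y, z >] = [< x, z >] + [< y, z >].
Proof. by have := lieb_linl 1 x y z; rewrite !scale1r. Qed.
Lemma liebDr x y z : [< z, x + y >] = [< z, x >] + [< z, y >].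
Proof. by have := lieb_linr 1 x y z; rewrite !scale1r. Qed.
Lemma lieb0l x : [< 0, x >] = 0.
Proof. by apply: (addrI [< 0, x >]); rewrite -liebDl !addr0. Qed.
Lemma lieb0r x : [< x, 0 >] = 0.
Proof. by apply: (addrI [< x, 0 >]); rewrite -liebDr !addr0. Qed.
Lemma liebZl a x y : [< a *: x, y >] = a *: [< x, y >].
Proof. by have := lieb_linl a x 0 y; rewrite !addr0 lieb0l addr0. Qed.
Lemma liebZr a x y : [< x, a *: y >] = a *: [< x, y >].
Proof. by have := lieb_linr a y 0 x; rewrite !addr0 lieb0r addr0. Qed.
Lemma liebC x y : [< x, y >] = - [< y, x >].
Proof.
apply/eqP; rewrite -addr_eq0; apply/eqP.
by have := liebb (x + y); rewrite liebDl !liebDr !liebb add0r addr0.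
Qed.
Lemma liebNr x y : [< x, - y >] = - [< x, y >].
Proof. by rewrite -scaleN1r liebZr scaleN1r. Qed.

Lemma lieb_suml (I : Type) (r : seq I) (F : I -> g) x :
  [< \sum_(i <- r) F i, x >] = \sum_(i <- r) [< F i, x >].
Proof.
by elim: r => [|i r IH]; rewrite ?big_nil ?lieb0l// !big_cons liebDl IH.
Qed.
Lemma lieb_sumr (I : Type) (r : seq I) (F : I -> g) x :
  [< x, \sum_(i <- r) F i >] = \sum_(i <- r) [< x, F i >].
Proof.
by elim: r => [|i r IH]; rewrite ?big_nil ?lieb0r// !big_cons liebDr IH.
Qed.

Section Module.
Context (V : lieModType g).
Implicit Types u v : V.

Lemma lactDl x y v : lact (x + y) v = lact x v + lact y v.
Proof. by have := lact_linl 1 x y v; rewrite !scale1r. Qed.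
Lemma lactDr x u v : lact x (u + v) = lact x u + lact x v.
Proof. by have := lact_linr 1 x u v; rewrite !scale1r. Qed.
Lemma lact0l v : lact (0 : g) v = 0.
Proof. by apply: (addrI (lact (0 : g) v)); rewrite -lactDl !addr0. Qed.
Lemma lact0r x : lact x (0 : V) = 0.
Proof. by apply: (addrI (lact x 0)); rewrite -lactDr !addr0. Qed.
Lemma lactZl a x v : lact (a *: x) v = a *: lact x v.
Proof. by have := lact_linl a x 0 v; rewrite !addr0 lact0l addr0. Qed.
Lemma lactZr a x v : lact x (a *: v) = a *: lact x v.
Proof. by have := lact_linr a x v 0; rewrite !addr0 lact0r addr0. Qed.
Lemma lact_suml (I : Type) (r : seq I) (P : pred I) (F : I -> g) v :
  lact (\sum_(i <- r | P i) F i) v = \sum_(i <- r | P i) lact (F i) v.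
Proof.
elim: r => [|i r IH]; rewrite ?big_nil ?lact0l// !big_cons.
by case: (P i); rewrite // lactDl IH.
Qed.
Lemma lact_sumr (I : Type) (r : seq I) (F : I -> V) x :
  lact x (\sum_(i <- r) F i) = \sum_(i <- r) lact x (F i).
Proof.
by elim: r => [|i r IH]; rewrite ?big_nil ?lact0r// !big_cons lactDr IH.
Qed.

(* [A] is the set of acting elements: [[set: g]], or a subalgebra of [g] when
   [V] is restricted to it. *)
Definition submodule (A : set g) (X : set V) :=
  subspace X /\ forall x v, A x -> X v -> X (lact x v).

Definition simple_module (A : set g) (W : set V) :=
  [/\ submodule A W, W <> [set 0] &
      forall X, submodule A X -> X `<=` W -> X = [set 0] \/ X = W].

End Module.

Record lieSub := LieSub {
  lie_pred :> {pred g};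
  lie_pred_submod : submod_closed lie_pred;
  lie_pred_lieb : {in lie_pred &, forall x y, [< x, y >] \in lie_pred}
}.

Lemma lie_predD (S : lieSub) : {in S &, forall x y, x + y \in S}.
Proof.
by move=> x y Sx Sy; rewrite -[x]scale1r; apply: (lie_pred_submod S).2.
Qed.

Lemma lie_predN (S : lieSub) : {in S, forall x, - x \in S}.
Proof.
have [S0 SD] := lie_pred_submod S.
by move=> x Sx; rewrite -scaleN1r -[_ *: _]addr0; apply: SD.
Qed.

End LieTheory.

Section LieSubType.
Context (K : fieldType) (g : lieAlgType K) (S : lieSub g).

Record lie_sub := LSub { lsval : g; _ : lsval \in S }.

HB.instance Definition _ := [isSub for lsval].
HB.instance Definition _ := [Choice of lie_sub by <:].
HB.instance Definition _ := GRing.SubChoice_isSubLmodule.Build K g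
  (lie_pred S) lie_sub (GRing.submod_closed_semi (lie_pred_submod S)).

Definition lsub_lieb (x y : lie_sub) : lie_sub :=
  LSub (lie_pred_lieb (valP x) (valP y)).

Fact lsub_linl a x y z :
  lsub_lieb (a *: x + y) z = a *: lsub_lieb x z + lsub_lieb y z.
Proof. by apply/val_inj; rewrite /= lieb_linl. Qed.
Fact lsub_linr a x y z :
  lsub_lieb z (a *: x + y) = a *: lsub_lieb z x + lsub_lieb z y.
Proof. by apply/val_inj; rewrite /= lieb_linr. Qed.
Fact lsub_bb x : lsub_lieb x x = 0.
Proof. by apply/val_inj; rewrite /= liebb. Qed.
Fact lsub_jacobi x y z :
  lsub_lieb x (lsub_lieb y z) + lsub_lieb y (lsub_lieb z x)
  + lsub_lieb z (lsub_lieb x y) = 0.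
Proof. by apply/val_inj; rewrite /= lieb_jacobi. Qed.

HB.instance Definition _ := Lmodule_isLieAlgebra.Build K lie_sub
  lsub_linl lsub_linr lsub_bb lsub_jacobi.

End LieSubType.

Coercion lie_sub : lieSub >-> Sortclass.

(* U(g) as the unital associative algebra presented by the generators [UGen x],
   x : g, subject to linearity of [UGen] and x y - y x = [< x, y >]. *)
Section Enveloping.
Context (K : fieldType) (g : lieAlgType K).

Inductive uterm :=
| UZero | UOne | UGen of g
| UAdd of uterm & uterm | UMul of uterm & uterm | UScale of K & uterm.

Definition USub s t := UAdd s (UScale (-1) t).

Inductive ueq : uterm -> uterm -> Prop :=
| ueq_refl s : ueq s s
| ueq_sym s t : ueq s t -> ueq t s
| ueq_trans s t r : ueq s t -> ueq t r -> ueq s r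
| ueq_add s s' t t' : ueq s s' -> ueq t t' -> ueq (UAdd s t) (UAdd s' t')
| ueq_mul s s' t t' : ueq s s' -> ueq t t' -> ueq (UMul s t) (UMul s' t')
| ueq_scale a s s' : ueq s s' -> ueq (UScale a s) (UScale a s')
| ueq_addA s t r : ueq (UAdd s (UAdd t r)) (UAdd (UAdd s t) r)
| ueq_addC s t : ueq (UAdd s t) (UAdd t s)
| ueq_add0 s : ueq (UAdd UZero s) s
| ueq_addN s : ueq (USub s s) UZero
| ueq_scaleA a b s : ueq (UScale a (UScale b s)) (UScale (a * b) s)
| ueq_scale1 s : ueq (UScale 1 s) s
| ueq_scaleDr a s t : ueq (UScale a (UAdd s t)) (UAdd (UScale a s) (UScale a t))
| ueq_scaleDl a b s : ueq (UScale (a + b) s) (UAdd (UScale a s) (UScale b s))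
| ueq_mulA s t r : ueq (UMul s (UMul t r)) (UMul (UMul s t) r)
| ueq_1mul s : ueq (UMul UOne s) s
| ueq_mul1 s : ueq (UMul s UOne) s
| ueq_mulDl s t r : ueq (UMul (UAdd s t) r) (UAdd (UMul s r) (UMul t r))
| ueq_mulDr s t r : ueq (UMul r (UAdd s t)) (UAdd (UMul r s) (UMul r t))
| ueq_scaleAl a s t : ueq (UScale a (UMul s t)) (UMul (UScale a s) t)
| ueq_scaleAr a s t : ueq (UScale a (UMul s t)) (UMul s (UScale a t))
| ueq_gen_lin a x y :
    ueq (UGen (a *: x + y)) (UAdd (UScale a (UGen x)) (UGen y))
| ueq_gen_lieb x y :
    ueq (UGen [< x, y >])
        (USub (UMul (UGen x) (UGen y)) (UMul (UGen y) (UGen x))).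

HB.instance Definition _ := gen_eqMixin uterm.
HB.instance Definition _ := gen_choiceMixin uterm.

Definition ueqb s t := `[< ueq s t >].

Fact ueqb_refl : reflexive ueqb.
Proof. by move=> s; apply/asboolP/ueq_refl. Qed.
Fact ueqb_sym : symmetric ueqb.
Proof. by move=> s t; apply/asboolP/asboolP => /ueq_sym. Qed.
Fact ueqb_trans : transitive ueqb.
Proof.
by move=> t s r /asboolP st /asboolP tr; apply/asboolP/ueq_trans/tr.
Qed.

Canonical ueqb_equiv := EquivRel ueqb ueqb_refl ueqb_sym ueqb_trans.

Definition uea := {eq_quot ueqb}%qT.
HB.instance Definition _ := Choice.on uea.
HB.instance Definition _ := EqQuotient.on uea.

Definition upi (s : uterm) : uea := (\pi_uea s)%qT.

Lemma upiP s t : ueq s t <-> upi s = upi t.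
Proof.
split=> [st|/eqP]; first by apply/eqP; rewrite /upi eqmodE; apply/asboolP.
by rewrite /upi eqmodE => /asboolP.
Qed.

Lemma uea_ind (P : uea -> Prop) : (forall s, P (upi s)) -> forall u, P u.
Proof. by move=> Ps u; rewrite -[u]reprK; apply: Ps. Qed.

Lemma ueq_repr s : ueq (repr (upi s)) s.
Proof. by apply/upiP; rewrite /upi reprK. Qed.

Definition uadd (u v : uea) := upi (UAdd (repr u) (repr v)).
Definition umul (u v : uea) := upi (UMul (repr u) (repr v)).
Definition uscale a (u : uea) := upi (UScale a (repr u)).
Definition uopp := uscale (-1).

Lemma uaddE s t : uadd (upi s) (upi t) = upi (UAdd s t).
Proof. by apply/upiP/ueq_add; apply: ueq_repr. Qed.
Lemma umulE s t : umul (upi s) (upi t) = upi (UMul s t).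
Proof. by apply/upiP/ueq_mul; apply: ueq_repr. Qed.
Lemma uscaleE a s : uscale a (upi s) = upi (UScale a s).
Proof. by apply/upiP/ueq_scale; apply: ueq_repr. Qed.

Definition uE := (uaddE, umulE, uscaleE).

Fact uaddA : associative uadd.
Proof.
by do 3!elim/uea_ind => ?; rewrite !uE; apply/upiP; apply: ueq_addA.
Qed.
Fact uaddC : commutative uadd.
Proof. by do 2!elim/uea_ind => ?; rewrite !uE; apply/upiP; apply: ueq_addC. Qed.
Fact uadd0 : left_id (upi UZero) uadd.
Proof. by elim/uea_ind => ?; rewrite !uE; apply/upiP; apply: ueq_add0. Qed.
Fact uaddN : left_inverse (upi UZero) uopp uadd.
Proof.
by elim/uea_ind => ?; rewrite uaddC /uopp !uE; apply/upiP; apply: ueq_addN.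
Qed.
HB.instance Definition _ := GRing.isZmodule.Build uea uaddA uaddC uadd0 uaddN.
Lemma upiD s t : upi s + upi t = upi (UAdd s t). Proof. exact: uaddE. Qed.

Fact umulA : associative umul.
Proof.
by do 3!elim/uea_ind => ?; rewrite !uE; apply/upiP; apply: ueq_mulA.
Qed.
Fact u1mul : left_id (upi UOne) umul.
Proof. by elim/uea_ind => ?; rewrite !uE; apply/upiP; apply: ueq_1mul. Qed.
Fact umul1 : right_id (upi UOne) umul.
Proof. by elim/uea_ind => ?; rewrite !uE; apply/upiP; apply: ueq_mul1. Qed.
Fact umulDl : left_distributive umul uadd.
Proof.
by do 3!elim/uea_ind => ?; rewrite !uE; apply/upiP; apply: ueq_mulDl.
Qed.
Fact umulDr : right_distributive umul uadd.
Proof.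
by do 3!elim/uea_ind => ?; rewrite !uE; apply/upiP; apply: ueq_mulDr.
Qed.

Fixpoint ueval (A : algType K) (f : g -> A) (s : uterm) : A :=
  match s with
  | UZero => 0
  | UOne => 1
  | UGen x => f x
  | UAdd s t => ueval f s + ueval f t
  | UMul s t => ueval f s * ueval f t
  | UScale a s => a *: ueval f s
  end.

Definition lie_hom_alg (A : algType K) (f : g -> A) :=
  (forall a x y, f (a *: x + y) = a *: f x + f y) /\
  (forall x y, f [< x, y >] = f x * f y - f y * f x).

Lemma ueval_eq (A : algType K) (f : g -> A) : lie_hom_alg f ->
  forall s t, ueq s t -> ueval f s = ueval f t.
Proof.
move=> [flin fbr] s t; elim=> {s t} /=;
  try by [move=> *; congruence | move=> *; rewrite ?scaleN1r ?fbr].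
- by move=> s t r; rewrite addrA.
- by move=> s t; rewrite addrC.
- by move=> s; rewrite add0r.
- by move=> s; rewrite scaleN1r subrr.
- by move=> a b s; rewrite scalerA.
- by move=> s; rewrite scale1r.
- by move=> a s t; rewrite scalerDr.
- by move=> a b s; rewrite scalerDl.
- by move=> s t r; rewrite mulrA.
- by move=> s; rewrite mul1r.
- by move=> s; rewrite mulr1.
- by move=> s t r; rewrite mulrDl.
- by move=> s t r; rewrite mulrDr.
- by move=> a s t; rewrite scalerAl.
- by move=> a s t; rewrite scalerAr.
Qed.

Fact uone_neq0 : upi UOne != upi UZero.
Proof.
have h0 : lie_hom_alg (fun _ : g => 0 : K^o).
  by split=> *; rewrite ?scaler0 ?mulr0 ?subr0 ?addr0.
by apply/eqP => /upiP /(ueval_eq h0) /= /eqP; rewrite oner_eq0.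
Qed.

HB.instance Definition _ := GRing.Zmodule_isNzRing.Build uea
  umulA u1mul umul1 umulDl umulDr uone_neq0.
Lemma upiM s t : upi s * upi t = upi (UMul s t). Proof. exact: umulE. Qed.

Fact uscaleA a b u : uscale a (uscale b u) = uscale (a * b) u.
Proof. by elim/uea_ind: u => s; rewrite !uE; apply/upiP/ueq_scaleA. Qed.
Fact uscale1 : left_id 1 uscale.
Proof. by elim/uea_ind => s; rewrite !uE; apply/upiP/ueq_scale1. Qed.
Fact uscaleDr : right_distributive uscale +%R.
Proof.
move=> a; do 2!elim/uea_ind => ?.
by rewrite !(upiD, uscaleE); apply/upiP/ueq_scaleDr.
Qed.
Fact uscaleDl u : {morph uscale^~ u : a b / a + b}.
Proof.
by move=> a b; elim/uea_ind: u => ?; rewrite !(uscaleE, upiD);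
   apply/upiP/ueq_scaleDl.
Qed.
HB.instance Definition _ := GRing.Zmodule_isLmodule.Build K uea
  uscaleA uscale1 uscaleDr uscaleDl.
Lemma upiZ a s : a *: upi s = upi (UScale a s). Proof. exact: uscaleE. Qed.

Fact uscaleAl a (u v : uea) : a *: (u * v) = (a *: u) * v.
Proof.
elim/uea_ind: u => s; elim/uea_ind: v => t.
by rewrite !(upiM, upiZ); apply/upiP/ueq_scaleAl.
Qed.
Fact uscaleAr a (u v : uea) : a *: (u * v) = u * (a *: v).
Proof.
elim/uea_ind: u => s; elim/uea_ind: v => t.
by rewrite !(upiM, upiZ); apply/upiP/ueq_scaleAr.
Qed.
HB.instance Definition _ := GRing.Lmodule_isLalgebra.Build K uea uscaleAl.
HB.instance Definition _ := GRing.Lalgebra_isAlgebra.Build K uea uscaleAr.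

Definition uiota (x : g) : uea := upi (UGen x).

Lemma uiota_lie : lie_hom_alg uiota.
Proof.
split=> [a x y|x y]; rewrite /uiota.
- by rewrite upiZ upiD; apply/upiP/ueq_gen_lin.
- by rewrite -scaleN1r !upiM upiZ upiD; apply/upiP/ueq_gen_lieb.
Qed.

(* The algebra morphism extending [f], for [f] satisfying [lie_hom_alg]. *)
Definition ulift (A : algType K) (f : g -> A) (u : uea) : A := ueval f (repr u).

Section Lift.
Context (A : algType K) (f : g -> A) (fP : lie_hom_alg f).

Lemma uliftE s : ulift f (upi s) = ueval f s.
Proof. exact/(ueval_eq fP)/ueq_repr. Qed.
Lemma ulift_iota x : ulift f (uiota x) = f x.
Proof. exact: uliftE. Qed.
Lemma ulift1 : ulift f 1 = 1.
Proof. exact: (uliftE UOne). Qed.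
Lemma uliftM u v : ulift f (u * v) = ulift f u * ulift f v.
Proof.
elim/uea_ind: u => s; elim/uea_ind: v => t.
by rewrite upiM !uliftE.
Qed.
Lemma ulift_lin a u v : ulift f (a *: u + v) = a *: ulift f u + ulift f v.
Proof.
elim/uea_ind: u => s; elim/uea_ind: v => t.
by rewrite upiZ upiD !uliftE.
Qed.

End Lift.

End Enveloping.

(* X (x)_A Y for a right A-module X and a left A-module Y, as the K-vector
   space generated by the pure tensors subject to bilinearity and
   xa (x) y = x (x) ay. *)
Section Tensor.
Context (K : fieldType) (A : Type) (X Y : lmodType K).
Context (rmul : X -> A -> X) (lmul : A -> Y -> Y).

Inductive tterm :=
| TZero | TPure of X & Y | TAdd of tterm & tterm | TScale of K & tterm.

Inductive teq : tterm -> tterm -> Prop :=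
| teq_refl s : teq s s
| teq_sym s t : teq s t -> teq t s
| teq_trans s t r : teq s t -> teq t r -> teq s r
| teq_add s s' t t' : teq s s' -> teq t t' -> teq (TAdd s t) (TAdd s' t')
| teq_scale a s s' : teq s s' -> teq (TScale a s) (TScale a s')
| teq_addA s t r : teq (TAdd s (TAdd t r)) (TAdd (TAdd s t) r)
| teq_addC s t : teq (TAdd s t) (TAdd t s)
| teq_add0 s : teq (TAdd TZero s) s
| teq_addN s : teq (TAdd s (TScale (-1) s)) TZero
| teq_scaleA a b s : teq (TScale a (TScale b s)) (TScale (a * b) s)
| teq_scale1 s : teq (TScale 1 s) s
| teq_scaleDr a s t : teq (TScale a (TAdd s t)) (TAdd (TScale a s) (TScale a t))
| teq_scaleDl a b s : teq (TScale (a + b) s) (TAdd (TScale a s) (TScale b s))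
| teq_linl a x x' y :
    teq (TPure (a *: x + x') y) (TAdd (TScale a (TPure x y)) (TPure x' y))
| teq_linr a x y y' :
    teq (TPure x (a *: y + y')) (TAdd (TScale a (TPure x y)) (TPure x y'))
| teq_bal x a y : teq (TPure (rmul x a) y) (TPure x (lmul a y)).

HB.instance Definition _ := gen_eqMixin tterm.
HB.instance Definition _ := gen_choiceMixin tterm.

Definition teqb s t := `[< teq s t >].

Fact teqb_refl : reflexive teqb.
Proof. by move=> s; apply/asboolP/teq_refl. Qed.
Fact teqb_sym : symmetric teqb.
Proof. by move=> s t; apply/asboolP/asboolP => /teq_sym. Qed.
Fact teqb_trans : transitive teqb.
Proof.
by move=> t s r /asboolP st /asboolP tr; apply/asboolP/teq_trans/tr.
Qed.

Canonical teqb_equiv := EquivRel teqb teqb_refl teqb_sym teqb_trans.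

Definition tensor := {eq_quot teqb}%qT.
HB.instance Definition _ := Choice.on tensor.
HB.instance Definition _ := EqQuotient.on tensor.

Definition tpi (s : tterm) : tensor := (\pi_tensor s)%qT.

Lemma tpiP s t : teq s t <-> tpi s = tpi t.
Proof.
split=> [st|/eqP]; first by apply/eqP; rewrite /tpi eqmodE; apply/asboolP.
by rewrite /tpi eqmodE => /asboolP.
Qed.

Lemma tensor_ind (P : tensor -> Prop) :
  (forall s, P (tpi s)) -> forall u, P u.
Proof. by move=> Ps u; rewrite -[u]reprK; apply: Ps. Qed.

Lemma teq_repr s : teq (repr (tpi s)) s.
Proof. by apply/tpiP; rewrite /tpi reprK. Qed.

Definition tadd (u v : tensor) := tpi (TAdd (repr u) (repr v)).
Definition tscale a (u : tensor) := tpi (TScale a (repr u)).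
Definition topp := tscale (-1).

Lemma taddE s t : tadd (tpi s) (tpi t) = tpi (TAdd s t).
Proof. by apply/tpiP/teq_add; apply: teq_repr. Qed.
Lemma tscaleE a s : tscale a (tpi s) = tpi (TScale a s).
Proof. by apply/tpiP/teq_scale; apply: teq_repr. Qed.

Fact taddA : associative tadd.
Proof. by do 3!elim/tensor_ind => ?; rewrite !taddE; apply/tpiP/teq_addA. Qed.
Fact taddC : commutative tadd.
Proof. by do 2!elim/tensor_ind => ?; rewrite !taddE; apply/tpiP/teq_addC. Qed.
Fact tadd0 : left_id (tpi TZero) tadd.
Proof. by elim/tensor_ind => ?; rewrite !taddE; apply/tpiP/teq_add0. Qed.
Fact taddN : left_inverse (tpi TZero) topp tadd.
Proof.
by elim/tensor_ind => ?; rewrite taddC /topp tscaleE taddE; apply/tpiP/teq_addN.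
Qed.
HB.instance Definition _ :=
  GRing.isZmodule.Build tensor taddA taddC tadd0 taddN.
Lemma tpiD s t : tpi s + tpi t = tpi (TAdd s t). Proof. exact: taddE. Qed.

Fact tscaleA a b u : tscale a (tscale b u) = tscale (a * b) u.
Proof. by elim/tensor_ind: u => s; rewrite !tscaleE; apply/tpiP/teq_scaleA. Qed.
Fact tscale1 : left_id 1 tscale.
Proof. by elim/tensor_ind => s; rewrite tscaleE; apply/tpiP/teq_scale1. Qed.
Fact tscaleDr : right_distributive tscale +%R.
Proof.
move=> a; do 2!elim/tensor_ind => ?.
by rewrite !(tpiD, tscaleE); apply/tpiP/teq_scaleDr.
Qed.
Fact tscaleDl u : {morph tscale^~ u : a b / a + b}.
Proof.
by move=> a b; elim/tensor_ind: u => ?; rewrite !(tscaleE, tpiD);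
   apply/tpiP/teq_scaleDl.
Qed.
HB.instance Definition _ := GRing.Zmodule_isLmodule.Build K tensor
  tscaleA tscale1 tscaleDr tscaleDl.
Lemma tpiZ a s : a *: tpi s = tpi (TScale a s). Proof. exact: tscaleE. Qed.

Definition tpure (x : X) (y : Y) : tensor := tpi (TPure x y).

Fixpoint tterm_map (phi : X -> X) (s : tterm) : tterm :=
  match s with
  | TZero => TZero
  | TPure x y => TPure (phi x) y
  | TAdd s t => TAdd (tterm_map phi s) (tterm_map phi t)
  | TScale a s => TScale a (tterm_map phi s)
  end.

(* phi (x) id, for [phi] linear and commuting with the right action. *)
Definition tmap (phi : X -> X) (u : tensor) : tensor :=
  tpi (tterm_map phi (repr u)).

Definition right_linear (phi : X -> X) :=
  (forall a x y, phi (a *: x + y) = a *: phi x + phi y) /\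
  (forall x a, phi (rmul x a) = rmul (phi x) a).

Lemma tterm_map_eq phi : right_linear phi ->
  forall s t, teq s t -> teq (tterm_map phi s) (tterm_map phi t).
Proof.
move=> [plin pr] s t; elim=> {s t} /=; rewrite ?plin ?pr; try by constructor.
- by move=> s t r _ st _ tr; apply: teq_trans tr.
- by move=> a x x' y; rewrite plin; constructor.
- by move=> x a y; rewrite pr; constructor.
Qed.

Lemma tmapE phi : right_linear phi -> forall s,
  tmap phi (tpi s) = tpi (tterm_map phi s).
Proof. by move=> phiP s; apply/tpiP/tterm_map_eq/teq_repr. Qed.

Lemma tmap_lin phi : right_linear phi -> forall a u v,
  tmap phi (a *: u + v) = a *: tmap phi u + tmap phi v.
Proof.
move=> phiP a u v; elim/tensor_ind: u => s; elim/tensor_ind: v => t.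
by rewrite tpiZ tpiD !tmapE //= tpiZ tpiD.
Qed.

Lemma tensor_ind_pure (P : tensor -> Prop) : P 0 ->
  (forall x y, P (tpure x y)) -> (forall u v, P u -> P v -> P (u + v)) ->
  (forall a u, P u -> P (a *: u)) -> forall u, P u.
Proof.
move=> P0 Pp PD PZ; elim/tensor_ind; elim=> [|x y|s Ps t Pt|a s Ps].
- exact: P0.
- exact: Pp.
- by rewrite -tpiD; apply: PD.
- by rewrite -tpiZ; apply: PZ.
Qed.

End Tensor.

Section Triangular.
Context (K : fieldType) (g : lieAlgType K).

Definition ad_weight_space (h : lieSub g) (alpha : dual h) : set g :=
  [set x | forall y : h, [< lsval y, x >] = alpha y *: x].

Definition root_space (h n : lieSub g) (alpha : dual h) : set g :=
  [set` n] `&` ad_weight_space alpha.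

Definition add_monoid (V : zmodType) (D : set V) : set V :=
  [set v | exists2 s : seq V, (forall b, b \in s -> D b) & v = \sum_(b <- s) b].

Record triangular := Triangular {
  tri_neg : lieSub g;
  tri_cart : lieSub g;
  tri_pos : lieSub g;
  tri_neg_neq0 : exists2 x : g, x \in tri_neg & x != 0;
  tri_cart_neq0 : exists2 x : g, x \in tri_cart & x != 0;
  tri_pos_neq0 : exists2 x : g, x \in tri_pos & x != 0;
  tri_sum : forall x : g, exists! t : tri_neg * tri_cart * tri_pos,
    x = lsval t.1.1 + lsval t.1.2 + lsval t.2;
  tri_abelian : {in tri_cart &, forall x y, [< x, y >] = 0};
  tri_neg_stable : {in tri_cart & tri_neg, forall x y, [< x, y >] \in tri_neg};
  tri_pos_stable : {in tri_cart & tri_pos, forall x y, [< x, y >] \in tri_pos};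
  tri_roots : exists D : set (dual tri_cart),
    [/\ lin_indep D,
        is_direct_sum (@root_space tri_cart tri_pos) [set` tri_pos]
      & forall alpha, @root_space tri_cart tri_pos alpha <> [set 0] ->
          add_monoid D alpha /\ alpha <> 0];
  tri_sigma : exists sigma : g -> g,
    [/\ forall a x y, sigma (a *: x + y) = a *: sigma x + sigma y,
        involutive sigma,
        forall x y, sigma [< x, y >] = [< sigma y, sigma x >],
        sigma @` [set` tri_pos] = [set` tri_neg]
      & {in tri_cart, forall x, sigma x = x}]
}.

End Triangular.

Section Verma.
Context (K : fieldType) (g : lieAlgType K) (td : triangular g).
Let nm := tri_neg td.
Let h := tri_cart td.
Let np := tri_pos td.

Definition tri_dec (x : g) : nm * h * np := sval (cid (tri_sum td x)).

Lemma tri_decE x :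
  x = lsval (tri_dec x).1.1 + lsval (tri_dec x).1.2 + lsval (tri_dec x).2.
Proof. by rewrite /tri_dec; case: cid => t []. Qed.

Lemma tri_dec_uniq x (t : nm * h * np) :
  x = lsval t.1.1 + lsval t.1.2 + lsval t.2 -> tri_dec x = t.
Proof. by rewrite /tri_dec; case: cid => u [_ +] /= xE; apply. Qed.

Lemma tri_dec_lin a x y : tri_dec (a *: x + y) =
  (a *: (tri_dec x).1.1 + (tri_dec y).1.1,
   a *: (tri_dec x).1.2 + (tri_dec y).1.2,
   a *: (tri_dec x).2 + (tri_dec y).2).
Proof.
apply: tri_dec_uniq; rewrite [in LHS](tri_decE x) [in LHS](tri_decE y) /=.
by rewrite !scalerDr addrACA (addrACA (a *: _)).
Qed.

Definition borel_pred : {pred g} := fun x =>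
  `[< exists2 y, y \in h & exists2 z, z \in np & x = y + z >].

Fact borel_submod : submod_closed borel_pred.
Proof.
have [h0 hD] := lie_pred_submod h; have [n0 nD] := lie_pred_submod np.
split; first by apply/asboolP; exists 0 => //; exists 0; rewrite ?addr0.
move=> a u v /asboolP[y hy [z nz ->]] /asboolP[y' hy' [z' nz' ->]].
apply/asboolP; exists (a *: y + y'); first exact: hD.
exists (a *: z + z'); first exact: nD.
by rewrite scalerDr addrACA.
Qed.

Fact borel_lieb : {in borel_pred &, forall x y, [< x, y >] \in borel_pred}.
Proof.
have [h0 _] := lie_pred_submod h.
move=> u v /asboolP[y hy [z nz ->]] /asboolP[y' hy' [z' nz' ->]].
apply/asboolP; exists 0 => //.
exists ([< y, z' >] + [< z, y' >] + [< z, z' >]).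
  apply: lie_predD; last exact: lie_pred_lieb.
  apply: lie_predD; first exact: tri_pos_stable.
  rewrite liebC; apply: lie_predN.
  exact: tri_pos_stable.
by rewrite add0r liebDl !liebDr (tri_abelian hy hy') add0r addrA.
Qed.

Definition borel : lieSub g := LieSub borel_submod borel_lieb.

Context (mu : dual h).

(* C_mu as a morphism U(h (+) n_+) -> K, h + x |-> mu(h); see [borel_charE]. *)
Definition borel_char (b : borel) : K^o := mu (tri_dec (lsval b)).1.2.

Lemma borel_charE (y : h) (z : np) (b : borel) :
  lsval b = lsval y + lsval z -> borel_char b = mu y.
Proof.
move=> bE; rewrite /borel_char (@tri_dec_uniq _ (0, y, z)) //=.
by rewrite add0r.
Qed.

Lemma borel_decomp (b : borel) :
  exists y : h, exists z : np, lsval b = lsval y + lsval z.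
Proof.
case: b => x /= /asboolP[y hy [z nz ->]].
by exists (LSub hy); exists (LSub nz).
Qed.

Lemma borel_char_lie : lie_hom_alg borel_char.
Proof.
split=> [a x y|x y].
  by rewrite /borel_char /= tri_dec_lin /= dual_lin.
rewrite [_ * _]mulrC subrr.
have [y1 [z1 xE]] := borel_decomp x; have [y2 [z2 yE]] := borel_decomp y.
have nz : [< lsval y1, lsval z2 >] + [< lsval z1, lsval y2 >]
          + [< lsval z1, lsval z2 >] \in np.
  apply: lie_predD; last by apply: lie_pred_lieb; apply: valP.
  apply: lie_predD; first by apply: tri_pos_stable; apply: valP.
  rewrite liebC; apply: lie_predN.
  by apply: tri_pos_stable; apply: valP.
rewrite (@borel_charE 0 (LSub nz)) /=.
  by have := dual_lin mu (-1) 0 0; rewrite scaler0 addr0 mulN1r addNr.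
rewrite xE yE liebDl !liebDr add0r.
by rewrite (tri_abelian (valP y1) (valP y2)) add0r addrA.
Qed.

(* U(g) as a right U(h (+) n_+)-module. *)
Definition uea_rmul (u : uea g) (b : uea borel) : uea g :=
  u * ulift (fun x : borel => uiota (lsval x)) b.

Definition char_lmul (b : uea borel) (z : K^o) : K^o := ulift borel_char b * z.

Definition verma := tensor uea_rmul char_lmul.
HB.instance Definition _ := GRing.Lmodule.on verma.

Definition verma_act (x : g) : verma -> verma := tmap (fun u => uiota x * u).

Fact verma_right_linear (x : g) :
  right_linear uea_rmul (fun u => uiota x * u).
Proof.
split=> [a u v|u b]; last by rewrite /uea_rmul mulrA.
by rewrite mulrDr scalerAr.
Qed.

Lemma verma_act_lin x a (u v : verma) :
  verma_act x (a *: u + v) = a *: verma_act x u + verma_act x v.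
Proof. exact: (tmap_lin (verma_right_linear x)). Qed.

Lemma verma_actE x u z :
  verma_act x (tpure uea_rmul char_lmul u z) = tpure _ _ (uiota x * u) z.
Proof. by rewrite /verma_act /tpure tmapE //; apply: verma_right_linear. Qed.

Lemma verma_actD x (u v : verma) :
  verma_act x (u + v) = verma_act x u + verma_act x v.
Proof. by have := verma_act_lin x 1 u v; rewrite !scale1r. Qed.
Lemma verma_act0 x : verma_act x 0 = 0.
Proof. by apply: (addrI (verma_act x 0)); rewrite -verma_actD !addr0. Qed.
Lemma verma_actZ x a (u : verma) : verma_act x (a *: u) = a *: verma_act x u.
Proof. by have := verma_act_lin x a u 0; rewrite verma_act0 !addr0. Qed.

Fact verma_linl a x y v :
  verma_act (a *: x + y) v = a *: verma_act x v + verma_act y v.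
Proof.
elim/tensor_ind_pure: v => [|u z|u v Hu Hv|b u Hu].
- by rewrite !verma_act0 scaler0 addr0.
- rewrite !verma_actE (uiota_lie g).1 mulrDl -scalerAl.
  by rewrite /tpure tpiZ tpiD; apply/tpiP/teq_linl.
- rewrite !verma_actD Hu Hv scalerDr addrACA //.
- by rewrite !verma_actZ Hu scalerDr !scalerA mulrC.
Qed.

Fact verma_lieb x y v : verma_act [< x, y >] v =
  verma_act x (verma_act y v) - verma_act y (verma_act x v).
Proof.
elim/tensor_ind_pure: v => [|u z|u v Hu Hv|b u Hu].
- by rewrite !verma_act0 subr0.
- rewrite !verma_actE (uiota_lie g).2 mulrBl -!mulrA addrC -scaleN1r.
  rewrite -[in RHS]scaleN1r addrC [in RHS]addrC /tpure tpiZ tpiD.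
  by rewrite addrC; apply/tpiP/teq_linl.
- by rewrite !verma_actD Hu Hv opprD addrACA.
- by rewrite !verma_actZ Hu scalerBr.
Qed.

HB.instance Definition _ := Lmodule_isLieModule.Build K g verma
  verma_linl (fun a x u v => verma_act_lin x a u v) verma_lieb.

End Verma.

Section Completion.
Context (K : fieldType) (g : lieAlgType K) (td : triangular g).
Let nm := tri_neg td.
Let h := tri_cart td.
Let np := tri_pos td.

Implicit Types (s : seq (dual h * g)) (x y : g).

Definition weight_seq s := forall p, p \in s -> @ad_weight_space _ _ h p.1 p.2.

Lemma weight_seq_cons p s :
  weight_seq (p :: s) <-> @ad_weight_space _ _ h p.1 p.2 /\ weight_seq s.
Proof.
split=> [ws|[wp ws] q].
  by split=> [|q qs]; apply: ws; rewrite inE ?eqxx ?qs ?orbT.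
by rewrite inE => /predU1P[->//|/ws].
Qed.

Lemma weight_seq_cat s t : weight_seq s -> weight_seq t -> weight_seq (s ++ t).
Proof. by move=> ws wt p; rewrite mem_cat => /orP[/ws|/wt]. Qed.

Lemma ad_weight0 (a : dual h) : @ad_weight_space _ _ h a 0.
Proof. by move=> y; rewrite lieb0r scaler0. Qed.

Lemma ad_weight_lin (a : dual h) c x y : @ad_weight_space _ _ h a x ->
  @ad_weight_space _ _ h a y -> @ad_weight_space _ _ h a (c *: x + y).
Proof.
move=> wx wy z; rewrite lieb_linr wx wy scalerDr !scalerA.
by rewrite [c * _]mulrC.
Qed.

Lemma ad_weight_indep (r : seq (dual h)) (y : dual h -> g) : uniq r ->
  (forall a, a \in r -> @ad_weight_space _ _ h a (y a)) ->
  \sum_(a <- r) y a = 0 -> forall a, a \in r -> y a = 0.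
Proof.
elim: r y => [//|b r IH] y /= /andP[bNr ur] wy.
have wb : @ad_weight_space _ _ h b (y b) by apply: wy; rewrite inE eqxx.
have wr a : a \in r -> @ad_weight_space _ _ h a (y a).
  by move=> ar; apply: wy; rewrite inE ar orbT.
rewrite big_cons => sum0.
have yr0 a : a \in r -> y a = 0.
  move=> ar.
  have [z za] : exists z : h, (a z : K) != b z.
    apply: contrapT => /forallNP abE; move: bNr; rewrite -(_ : a = b) ?ar //.
    by apply: dualP => z; apply/eqP; have := abE z => /negP; rewrite negbK.
  have := IH (fun a => (a z - b z) *: y a) ur.
  move=> /(_ _ _ a ar) /= H.
  have /eqP : (a z - b z) *: y a = 0.
    apply: H => [c cr w|].
      by rewrite liebZr (wr _ cr) !scalerA mulrC.
    transitivity ([< lsval z, y b + \sum_(a <- r) y a >]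
                  - b z *: (y b + \sum_(a <- r) y a)); last first.
      by rewrite sum0 lieb0r scaler0 subr0.
    rewrite liebDr wb lieb_sumr scalerDr opprD addrACA subrr add0r.
    rewrite scaler_sumr -sumrB; apply: eq_big_seq => c cr.
    by rewrite (wr _ cr) scalerBl.
  by rewrite scaler_eq0 subr_eq0 (negPf za) => /eqP.
move=> a; rewrite inE => /predU1P[->|/yr0//].
by move: sum0; rewrite big_seq big1 ?addr0 // => c /yr0.
Qed.

Lemma weight_seq_exists x :
  exists s, weight_seq s /\ x = \sum_(p <- s) p.2.
Proof.
have posE z : z \in np -> exists s, [/\ weight_seq s,
    forall p, p \in s -> p.2 \in np & z = \sum_(p <- s) p.2].
  have [D [_ [_ dec _] _]] := tri_roots td.
  by move=> /dec[s ws ->]; exists s; split=> // p /ws[].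
rewrite (tri_decE td x); move: (tri_dec td x) => [[u v] w] /=.
have [sw [ww _ ->]] := posE _ (valP w).
have [su [wu ->]] : exists s, weight_seq s /\ lsval u = \sum_(p <- s) p.2.
  have [sg [sgl sgi sga sgn sgh]] := tri_sigma td.
  have : [set` nm] (lsval u) by apply: (valP u).
  rewrite -sgn => -[z /posE[s [ws _ ->]] <-].
  exists [seq (- p.1, sg p.2) | p <- s]; split.
    move=> _ /mapP[p ps ->] y /=.
    have sgZ c t : sg (c *: t) = c *: sg t.
      have sg0 : sg 0 = 0.
        by have := sgl (-1) 0 0; rewrite scaler0 addr0 scaleN1r addNr.
      by have := sgl c t 0; rewrite sg0 !addr0.
    rewrite -{1}(sgh _ (valP y)) -sga liebC ws // -scaleNr sgZ.
    by [].

  rewrite big_map /= {ws}; elim: s => [|p s IH].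
    by rewrite !big_nil; have := sgl (-1) 0 0;
       rewrite scaler0 addr0 scaleN1r addNr.
  by rewrite !big_cons -IH -[in LHS](scale1r p.2) sgl scale1r.
exists (su ++ (0, lsval v) :: sw); split; last first.
  by rewrite big_cat big_cons /= addrA.
apply: weight_seq_cat => //; apply/weight_seq_cons; split=> //= y.
by rewrite (tri_abelian (valP y) (valP v)) scale0r.
Qed.

Definition weight_dec x : seq (dual h * g) := sval (cid (weight_seq_exists x)).

Lemma weight_decP x :
  weight_seq (weight_dec x) /\ x = \sum_(p <- weight_dec x) p.2.
Proof. exact: (svalP (cid (weight_seq_exists x))). Qed.

Context (M : lieModType g).

Definition weight_space (nu : dual h) : set M :=
  [set v | forall y : h, lact (lsval y) v = nu y *: v].

Lemma weight_space_lin nu a u v : weight_space nu u -> weight_space nu v ->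
  weight_space nu (a *: u + v).
Proof.
by move=> wu wv y; rewrite lact_linr wu wv scalerDr !scalerA [a * _]mulrC.
Qed.

Lemma weight_space0 nu : weight_space nu 0.
Proof. by move=> y; rewrite lact0r scaler0. Qed.

Lemma lact_weight a nu x v : @ad_weight_space _ _ h a x -> weight_space nu v ->
  weight_space (a + nu) (lact x v).
Proof.
move=> wx wv y; have := lact_lieb (lsval y) x v.
rewrite wx wv lactZr lactZl dualDE scalerDl => ->.
by rewrite subrK.
Qed.

Definition completion_pred : {pred dual h -> M} :=
  fun f => `[< forall nu, weight_space nu (f nu) >].

Fact completion_submod : submod_closed completion_pred.
Proof.
split; first by apply/asboolP => nu; apply: weight_space0.
move=> a f1 f2 /asboolP w1 /asboolP w2; apply/asboolP => nu.
exact: weight_space_lin.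
Qed.

(* The product of the weight spaces of [M]: families (f nu), nu in h^*, with
   [f nu] in the weight space of weight nu. *)
Record completion :=
  Completion { comp_fun :> dual h -> M; _ : comp_fun \in completion_pred }.

HB.instance Definition _ := [isSub for comp_fun].
HB.instance Definition _ := [Choice of completion by <:].
HB.instance Definition _ := GRing.SubChoice_isSubLmodule.Build K (dual h -> M)
  completion_pred completion (GRing.submod_closed_semi completion_submod).

Lemma completionP (f : completion) nu : weight_space nu (f nu).
Proof. by case: f => f /= /asboolP. Qed.

Lemma completion_ext (f1 f2 : completion) : (forall nu, f1 nu = f2 nu) -> f1 = f2.
Proof. by move=> E; apply/val_inj/funext. Qed.

Lemma completionDE (f1 f2 : completion) nu : (f1 + f2 : completion) nu = f1 nu + f2 nu.
Proof. by []. Qed.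
Lemma completionNE (f : completion) nu : (- f : completion) nu = - f nu.
Proof. by []. Qed.
Lemma completionZE a (f : completion) nu : (a *: f : completion) nu = a *: f nu.
Proof. by []. Qed.

(* If x = sum_alpha x_alpha with [x_alpha] of weight alpha, then
   (x . f)_nu = sum_alpha x_alpha . f_(nu - alpha). *)
Definition seq_act s (f : dual h -> M) (nu : dual h) : M :=
  \sum_(p <- s) lact p.2 (f (nu - p.1)).

Lemma seq_act_weight s (f : completion) nu :
  weight_seq s -> weight_space nu (seq_act s f nu).
Proof.
rewrite /seq_act; elim: s => [|p s IH].
  by rewrite big_nil => _; apply: weight_space0.
move=> /weight_seq_cons[wp ws]; rewrite big_cons -[lact _ _]scale1r.
apply: weight_space_lin; last exact: IH.
rewrite -[nu in weight_space nu](subrK p.1) addrC.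
exact: lact_weight (completionP _ _).
Qed.

Lemma seq_act0 s f nu :
  weight_seq s -> \sum_(p <- s) p.2 = 0 -> seq_act s f nu = 0.
Proof.
move=> ws s0; rewrite /seq_act.
pose r := undup (map fst s).
have sr p : p \in s -> p.1 \in r by rewrite mem_undup => /(map_f fst).
pose y a := \sum_(p <- s | p.1 == a) p.2.
have part (V : zmodType) (F : dual h * g -> V) :
    \sum_(p <- s) F p = \sum_(a <- r) \sum_(p <- s | p.1 == a) F p.
  rewrite (exchange_big_dep xpredT) //=; apply: eq_big_seq => p /sr pr.
  rewrite (eq_bigl (pred1 p.1)) => [|a]; last by rewrite /= eq_sym.
  by rewrite -big_filter filter_pred1_uniq ?undup_uniq // big_seq1.
have y0 : forall a, a \in r -> y a = 0.
  apply: ad_weight_indep; first exact: undup_uniq; last by rewrite -part.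
  move=> a _; rewrite /y big_seq_cond.
  elim/big_ind: _ => [|u v wu wv|p /andP[ps /eqP <-]]; last exact: ws.
    exact: ad_weight0.
  by rewrite -[u]scale1r; apply: ad_weight_lin.
rewrite part big_seq big1 // => a ar.
transitivity (lact (y a) (f (nu - a))); last by rewrite y0 // lact0l.
by rewrite lact_suml; apply: eq_bigr => p /eqP ->.
Qed.

Lemma seq_act_uniq s t f nu : weight_seq s -> weight_seq t ->
  \sum_(p <- s) p.2 = \sum_(p <- t) p.2 -> seq_act s f nu = seq_act t f nu.
Proof.
move=> ws wt st; apply/eqP; rewrite -subr_eq0; apply/eqP.
pose t' := [seq (p.1, - p.2) | p <- t].
have wt' : weight_seq t'.
  by move=> _ /mapP[p /wt wp ->] y /=; rewrite liebNr wp scalerN.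
transitivity (seq_act (s ++ t') f nu).
  rewrite /seq_act big_cat big_map -sumrN /=; congr (_ + _).
  by apply: eq_bigr => p _; rewrite -!scaleN1r lactZl.
apply: seq_act0; first exact: weight_seq_cat.
by rewrite big_cat big_map /= sumrN st subrr.
Qed.

Fact completion_act_subproof x (f : completion) :
  seq_act (weight_dec x) f \in completion_pred.
Proof.
by apply/asboolP => nu; apply: seq_act_weight; have [] := weight_decP x.
Qed.

Definition completion_act x (f : completion) : completion :=
  Completion (completion_act_subproof x f).

Lemma completion_actE s x (f : completion) nu : weight_seq s ->
  x = \sum_(p <- s) p.2 -> completion_act x f nu = seq_act s f nu.
Proof.
move=> ws xE; have [wd xE'] := weight_decP x.
by apply: seq_act_uniq => //; rewrite -xE'.
Qed.

Fact completion_linl a x y f : completion_act (a *: x + y) f =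
  a *: completion_act x f + completion_act y f.
Proof.
have [wx xE] := weight_decP x; have [wy yE] := weight_decP y.
apply: completion_ext => nu; rewrite completionDE completionZE.
pose s := [seq (p.1, a *: p.2) | p <- weight_dec x].
have ws : weight_seq s.
  move=> _ /mapP[p /wx wp ->] z /=.
  by rewrite liebZr wp !scalerA mulrC.
rewrite (completion_actE (s := s ++ weight_dec y)); last 2 first.
- exact: weight_seq_cat.
- by rewrite big_cat big_map /= -scaler_sumr -xE -yE.
rewrite /seq_act big_cat big_map /= scaler_sumr; congr (_ + _).
by apply: eq_bigr => p _; rewrite lactZl.
Qed.

Fact completion_linr a x f1 f2 : completion_act x (a *: f1 + f2) =
  a *: completion_act x f1 + completion_act x f2.
Proof.
apply: completion_ext => nu; rewrite completionDE completionZE /=.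
rewrite /seq_act scaler_sumr -big_split; apply: eq_bigr => p _ /=.
by rewrite -lact_linr.
Qed.

Fact completion_lieb x y f : completion_act [< x, y >] f =
  completion_act x (completion_act y f) - completion_act y (completion_act x f).
Proof.
have [ws xE] := weight_decP x; have [wt yE] := weight_decP y.
set s := weight_dec x in ws xE; set t := weight_dec y in wt yE.
pose st : seq (dual h * g) := [seq (p.1 + q.1, [< p.2, q.2 >]) | p <- s, q <- t].
have wst : weight_seq st.
  move=> _ /allpairsP[[p q] /= [/ws wp /wt wq ->]] z /=.
  have := lieb_jacobi (lsval z) p.2 q.2.
  rewrite wp liebZr (liebC q.2 (lsval z)) wq liebNr liebZr (liebC q.2 p.2).
  rewrite scalerN -addrA -opprD -scalerDl => /eqP.
  by rewrite subr_eq0 => /eqP ->; congr (_ *: _); rewrite addrC.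
have act2 (s' t' : seq (dual h * g)) u v nu : weight_seq s' -> weight_seq t' ->
    u = \sum_(p <- s') p.2 -> v = \sum_(p <- t') p.2 ->
    completion_act u (completion_act v f) nu =
    \sum_(p <- s') \sum_(q <- t') lact p.2 (lact q.2 (f (nu - (p.1 + q.1)))).
  move=> ws' wt' uE vE; rewrite (completion_actE _ _ ws' uE) /seq_act.
  apply: eq_bigr => p _; rewrite (completion_actE _ _ wt' vE) /seq_act.
  by rewrite lact_sumr; apply: eq_bigr => q _; rewrite opprD addrA.
apply: completion_ext => nu; rewrite completionDE completionNE.
rewrite (act2 s t) // (act2 t s) // [in X in _ - X]exchange_big -sumrB.
rewrite (@completion_actE st) //; last first.
  rewrite big_allpairs_dep /= [in LHS]xE [in LHS]yE lieb_suml.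
  by apply: eq_bigr => p _; rewrite lieb_sumr.
rewrite /seq_act big_allpairs_dep; apply: eq_bigr => p _ /=.
rewrite -sumrB; apply: eq_bigr => q _.
by rewrite lact_lieb [q.1 + _]addrC.
Qed.

HB.instance Definition _ := Lmodule_isLieModule.Build K g completion
  completion_linl completion_linr completion_lieb.

End Completion.

Section Whittaker.
Context (K : fieldType) (g : lieAlgType K) (n : lieSub g) (V : lieModType g).

Definition lie_character (lambda : dual n) :=
  forall x y : n, lambda [< x, y >] = 0.

Definition whittaker (lambda : dual n) : set V :=
  [set v | forall x : n, lact (lsval x) v = lambda x *: v].

End Whittaker.

(* Main.v *)
(* Let sigma be the anti-involution and B the contravariant form on M(mu), that
   is, the g-map M(mu) -> M(mu)^* (with g acting on the dual through sigma)
   sending the highest weight vector v to the coordinate of v.  Simplicity of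
   M(mu) makes B nondegenerate on both sides, distinct weight spaces are
   B-orthogonal, and every weight space is finite dimensional; hence each linear
   form on M(mu) is represented by a unique element of the completion.  Under
   this identification the Whittaker vectors of type lambda are the linear forms
   F with F(sigma(x) m) = lambda(x) F(m) for x in n_+.  Since M(mu) is free of
   rank one over U(n_-), such an F exists and is determined by F(v). *)
Require Import Defs.
From HB Require Import structures.
From mathcomp Require Import all_boot all_order all_algebra.
From mathcomp Require Import all_classical reals.
From mathcomp.real_closed Require Import complex.

Set Implicit Arguments.
Unset Strict Implicit.
Unset Printing Implicit Defensive.

Import Order.TTheory GRing.Theory Num.Theory.
Local Open Scope classical_set_scope.
Local Open Scope ring_scope.
Local Open Scope complex_scope.

(** * Subspaces, spans and linear maps *)

Section Subspaces.
Context (K : fieldType).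

Section Closure.
Context (V : lmodType K) (X : set V) (subX : subspace X).

Lemma subspaceD u v : X u -> X v -> X (u + v).
Proof. by move=> Xu Xv; rewrite -[u]scale1r; apply: subX.2. Qed.

Lemma subspaceZ a u : X u -> X (a *: u).
Proof. by move=> Xu; rewrite -[_ *: _]addr0; apply: subX.2 => //; apply: subX.1. Qed.

Lemma subspace_sum (I : eqType) (r : seq I) (F : I -> V) :
  (forall i, i \in r -> X (F i)) -> X (\sum_(i <- r) F i).
Proof.
move=> XF; rewrite big_seq; elim/big_ind: _ => //; first exact: subX.1.
exact: subspaceD.
Qed.

Lemma lin_span_sub (S : set V) : S `<=` X -> lin_span S `<=` X.
Proof.
move=> SX _ [s sS ->]; apply: subspace_sum => p /sS Sp.
by apply: subspaceZ; apply: SX.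
Qed.

End Closure.

Lemma lin_span_subspace (V : lmodType K) (S : set V) : subspace (lin_span S).
Proof.
split; first by exists [::]; rewrite ?big_nil.
move=> a _ _ [s sS ->] [t tS ->].
exists ([seq (a * p.1, p.2) | p <- s] ++ t) => [p|].
  by rewrite mem_cat => /orP[/mapP[q /sS Sq ->]//|/tS].
rewrite big_cat big_map /= scaler_sumr; congr (_ + _).
by apply: eq_bigr => p _; rewrite scalerA.
Qed.

Lemma lin_span_gen (V : lmodType K) (S : set V) v : S v -> lin_span S v.
Proof.
move=> Sv; exists [:: (1, v)]; last by rewrite big_seq1 scale1r.
by move=> p; rewrite inE => /eqP ->.
Qed.

Definition lin_maps (U V : lmodType K) : set (U -> V) :=
  [set f | forall a u v, f (a *: u + v) = a *: f u + f v].

Lemma lin_maps_subspace (U V : lmodType K) : subspace (@lin_maps U V).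
Proof.
split=> [a u v|b f1 f2 f1l f2l a u v].
  by rewrite [LHS](_ : _ = 0) // scaler0 add0r.
have E (w : U) : (b *: f1 + f2) w = b *: f1 w + f2 w by [].
by rewrite !E f1l f2l !scalerDr addrACA !scalerA mulrC.
Qed.

Section LinMap.
Context (U V : lmodType K) (f : U -> V) (fl : lin_maps f).

Lemma lin_map0 : f 0 = 0.
Proof. by have := fl (-1) 0 0; rewrite scaler0 addr0 scaleN1r addNr. Qed.
Lemma lin_mapD u v : f (u + v) = f u + f v.
Proof. by have := fl 1 u v; rewrite !scale1r. Qed.
Lemma lin_mapZ a u : f (a *: u) = a *: f u.
Proof. by have := fl a u 0; rewrite lin_map0 !addr0. Qed.
Lemma lin_mapN u : f (- u) = - f u.
Proof. by rewrite -!scaleN1r lin_mapZ. Qed.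
Lemma lin_mapB u v : f (u - v) = f u - f v.
Proof. by rewrite lin_mapD lin_mapN. Qed.
Lemma lin_map_sum (I : Type) (r : seq I) (F : I -> U) :
  f (\sum_(i <- r) F i) = \sum_(i <- r) f (F i).
Proof.
by elim: r => [|i r IH]; rewrite ?big_nil ?lin_map0 // !big_cons lin_mapD IH.
Qed.

End LinMap.

Lemma dual_lin_maps (V : lmodType K) (f : dual V) : @lin_maps V K^o f.
Proof. exact: dual_lin. Qed.

End Subspaces.

(** * Extending a Lie algebra action to the enveloping algebra *)

Section Action.
Context (K : fieldType) (g : lieAlgType K) (W : lmodType K).
Implicit Types (P : set W) (act : g -> W -> W).

(* The carrier is a subspace [P] of [W], so that spaces of linear maps can be
   handled inside the [lmodType] of all functions. *)
Record lie_action P act : Prop := LieAction {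
  lie_action_sub : subspace P;
  lie_action_stable : forall x w, P w -> P (act x w);
  lie_action_linl : forall a x y w, P w ->
    act (a *: x + y) w = a *: act x w + act y w;
  lie_action_linr : forall a x u v, P u -> P v ->
    act x (a *: u + v) = a *: act x u + act x v;
  lie_action_lieb : forall x y w, P w ->
    act [< x, y >] w = act x (act y w) - act y (act x w)
}.

(** Terms are evaluated directly on vectors: [act] is an action on [P] only, so it gives no morphism
    into an endomorphism algebra of [W] to which [ulift] would apply. *)
Fixpoint term_act act (s : uterm g) (w : W) : W :=
  match s with
  | UZero => 0
  | UOne => w
  | UGen x => act x w
  | UAdd s t => term_act act s w + term_act act t w
  | UMul s t => term_act act s (term_act act t w)
  | UScale a s => a *: term_act act s w
  end.

Definition uea_act act (u : uea g) (w : W) : W := term_act act (repr u) w.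

Context (P : set W) (act : g -> W -> W) (actP : lie_action P act).
Let subP := lie_action_sub actP.

Lemma lie_action_Z x a w : P w -> act x (a *: w) = a *: act x w.
Proof.
move=> Pw; have P0 := subP.1; have a0 : act x 0 = 0.
  by have := lie_action_linr actP (-1) x P0 P0;
     rewrite scaler0 addr0 scaleN1r addNr.
by have := lie_action_linr actP a x Pw P0; rewrite a0 !addr0.
Qed.

Lemma term_act_stable s w : P w -> P (term_act act s w).
Proof.
elim: s w => [||x|s Ps t Pt|s Ps t Pt|a s Ps] w Pw //=.
- exact: subP.1.
- exact: (lie_action_stable actP x Pw).
- by apply: subspaceD; auto.
- by auto.
- by apply: subspaceZ; auto.
Qed.

Lemma term_act_lin s a u v : P u -> P v ->
  term_act act s (a *: u + v) = a *: term_act act s u + term_act act s v.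
Proof.
elim: s a u v => [||x|s Hs t Ht|s Hs t Ht|b s Hs] a u v Pu Pv //=.
- by rewrite scaler0 addr0.
- exact: (lie_action_linr actP a x Pu Pv).
- by rewrite Hs // Ht // scalerDr addrACA.
- by rewrite Ht // Hs //; apply: term_act_stable.
- by rewrite Hs // scalerDr !scalerA mulrC.
Qed.

Lemma term_actD s u v : P u -> P v ->
  term_act act s (u + v) = term_act act s u + term_act act s v.
Proof. by move=> Pu Pv; have := term_act_lin s 1 Pu Pv; rewrite !scale1r. Qed.

Lemma term_actZ s a w : P w -> term_act act s (a *: w) = a *: term_act act s w.
Proof.
move=> Pw; have := term_act_lin s a Pw subP.1; rewrite addr0 => ->.
rewrite [term_act act s 0](_ : _ = 0) ?addr0 //.
have := term_act_lin s (-1) subP.1 subP.1.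
by rewrite scaler0 addr0 scaleN1r addNr.
Qed.

(** Each relation of the presentation turns into a module axiom or a law of [lie_action]. Products
    need the stability of [P], since the left factor acts on a transformed vector. *)
Lemma term_act_eq s t : ueq s t -> forall w, P w ->
  term_act act s w = term_act act t w.
Proof.
elim=> {s t} /=.
- by [].
- by move=> s t _ H w Pw; rewrite H.
- by move=> s t r _ H _ H' w Pw; rewrite H // H'.
- by move=> s s' t t' _ H _ H' w Pw; rewrite H // H'.
- by move=> s s' t t' _ H _ H' w Pw; rewrite H' // H //; apply: term_act_stable.
- by move=> a s s' _ H w Pw; rewrite H.
- by move=> s t r w _; rewrite addrA.
- by move=> s t w _; rewrite addrC.
- by move=> s w _; rewrite add0r.
- by move=> s w _; rewrite scaleN1r subrr.
- by move=> a b s w _; rewrite scalerA.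
- by move=> s w _; rewrite scale1r.
- by move=> a s t w _; rewrite scalerDr.
- by move=> a b s w _; rewrite scalerDl.
- by [].
- by [].
- by [].
- by [].
- by move=> s t r w Pw; rewrite term_actD //; apply: term_act_stable.
- by [].
- by move=> a s t w Pw; rewrite term_actZ //; apply: term_act_stable.
- by move=> a x y w Pw; exact: (lie_action_linl actP a x y Pw).
- by move=> x y w Pw; rewrite scaleN1r; exact: (lie_action_lieb actP x y Pw).
Qed.

Lemma uea_act_upi s w : P w -> uea_act act (upi s) w = term_act act s w.
Proof. exact/term_act_eq/ueq_repr. Qed.

Lemma uea_act_stable u w : P w -> P (uea_act act u w).
Proof. exact: term_act_stable. Qed.

Lemma uea_act1 w : P w -> uea_act act 1 w = w.
Proof. by move=> Pw; rewrite -[1]/(upi (UOne g)) uea_act_upi. Qed.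

Lemma uea_act_iota x w : P w -> uea_act act (uiota x) w = act x w.
Proof. exact: (@uea_act_upi (UGen x) w). Qed.

Lemma uea_actM u v w : P w ->
  uea_act act (u * v) w = uea_act act u (uea_act act v w).
Proof.
elim/uea_ind: u => s; elim/uea_ind: v => t Pw.
by rewrite upiM !uea_act_upi //; apply: term_act_stable.
Qed.

Lemma uea_act_linl a u v w : P w ->
  uea_act act (a *: u + v) w = a *: uea_act act u w + uea_act act v w.
Proof.
elim/uea_ind: u => s; elim/uea_ind: v => t Pw.
by rewrite upiZ upiD !uea_act_upi.
Qed.

Lemma uea_actZ u a w : P w -> uea_act act u (a *: w) = a *: uea_act act u w.
Proof. exact: term_actZ. Qed.

End Action.

(** The proof replaces the final factor 1 by any [v] satisfying [Q] and inducts on the term to its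
    left; a product of terms is then absorbed factor by factor. *)
Lemma uea_gen_ind (K : fieldType) (g : lieAlgType K) (Q : uea g -> Prop) :
  Q 0 -> Q 1 -> (forall a u v, Q u -> Q v -> Q (a *: u + v)) ->
  (forall x u, Q u -> Q (uiota x * u)) -> forall u, Q u.
Proof.
move=> Q0 Q1 Ql Qx u; rewrite -[u]mulr1; elim/uea_ind: u => s.
elim: s 1 Q1 => [||x|s Hs t Ht|s Hs t Ht|a s Hs] v Qv.
- by rewrite [upi _]/(0 : uea g) mul0r.
- by rewrite [upi _]/(1 : uea g) mul1r.
- exact: Qx.
- by rewrite -upiD mulrDl -[upi s * v]scale1r; apply: Ql; auto.
- by rewrite -upiM -mulrA; auto.
- by rewrite -upiZ -scalerAl -[_ *: _]addr0; apply: Ql; auto.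
Qed.

(** * Pure tensors and the universal property of Verma modules *)

Section TensorPure.
Context (K : fieldType) (A : Type) (X Y : lmodType K).
Context (rmul : X -> A -> X) (lmul : A -> Y -> Y).
Local Notation pure := (tpure rmul lmul).

Lemma tpure_linl a x x' y : pure (a *: x + x') y = a *: pure x y + pure x' y.
Proof. by rewrite /tpure tpiZ tpiD; apply/tpiP/teq_linl. Qed.

Lemma tpure_linr a x y y' : pure x (a *: y + y') = a *: pure x y + pure x y'.
Proof. by rewrite /tpure tpiZ tpiD; apply/tpiP/teq_linr. Qed.

Lemma tpure_bal x a y : pure (rmul x a) y = pure x (lmul a y).
Proof. exact/tpiP/teq_bal. Qed.

Lemma tpure0l y : pure 0 y = 0.
Proof.
by have := tpure_linl (-1) 0 0 y; rewrite scaler0 addr0 scaleN1r addNr.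
Qed.

Lemma tpureZr a x y : pure x (a *: y) = a *: pure x y.
Proof.
have := tpure_linr (-1) x 0 0; rewrite scaler0 addr0 scaleN1r addNr => x0.
by have := tpure_linr a x y 0; rewrite x0 !addr0.
Qed.

End TensorPure.

Section VermaUniversal.
Context (K : fieldType) (g : lieAlgType K) (td : triangular g).
Context (mu : dual (tri_cart td)).
Let nm := tri_neg td.
Let h := tri_cart td.
Let np := tri_pos td.
Local Notation M := (verma mu).

Definition verma_hw : M :=
  @tpure K _ _ _ (@uea_rmul K g td) (@char_lmul K g td mu) (1 : uea g) (1 : K^o).

(** Elements of U(g) are built from 1 by combinations and left multiplication by generators, so pure
    tensors are reached from [verma_hw] by scaling and by the action. *)
Lemma verma_gen_ind (Q : M -> Prop) :
  Q 0 -> Q verma_hw -> (forall a u v, Q u -> Q v -> Q (a *: u + v)) ->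
  (forall x v, Q v -> Q (lact x v)) -> forall v, Q v.
Proof.
move=> Q0 Qv Ql Qx.
have QZ a v : Q v -> Q (a *: v) by move=> Hv; rewrite -[_ *: _]addr0; apply: Ql.
elim/tensor_ind_pure => // [u z|u v Hu Hv]; last first.
  by rewrite -[u]scale1r; apply: Ql.
rewrite -[z]mulr1 tpureZr; apply: QZ.
elim/uea_gen_ind: u => [||a u v Hu Hv|x u Hu].
- by rewrite tpure0l.
- exact: Qv.
- by rewrite tpure_linl; apply: Ql.
- by rewrite -verma_actE; apply: Qx.
Qed.

Section Lift.
Context (W : lmodType K) (P : set W) (act : g -> W -> W).
Context (actP : lie_action P act) (n0 : W) (Pn0 : P n0).
Context (n0_pos : forall x, x \in np -> act x n0 = 0).
Context (n0_cart : forall y : h, act (lsval y) n0 = mu y *: n0).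

(** The [g]-map from M(mu) determined by a vector [n0] of weight [mu] killed by n_+. *)
Fixpoint tterm_lift (s : tterm (uea g) K^o) : W :=
  match s with
  | TZero => 0
  | TPure u z => (z : K) *: uea_act act u n0
  | TAdd s t => tterm_lift s + tterm_lift t
  | TScale a s => a *: tterm_lift s
  end.

(** This is what the balancing relation of the tensor product asks for. Both sides respect sums and
    products in [b], so generators decide, and on them only the Cartan part of [x] survives. *)
Lemma borel_act (b : uea (borel td)) :
  uea_act act (ulift (fun x : borel td => uiota (lsval x)) b) n0 =
  (ulift (borel_char mu) b : K) *: n0.
Proof.
have hom : lie_hom_alg (fun x : borel td => uiota (lsval x)).
  by split=> *; rewrite ?(uiota_lie g).1 ?(uiota_lie g).2.
elim/uea_ind: b => s; rewrite !uliftE //; last exact: borel_char_lie.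
elim: s => [||x|s Hs t Ht|s Hs t Ht|a s Hs] /=.
- by rewrite -[0]/(upi (UZero g)) (uea_act_upi actP) // scale0r.
- by rewrite (uea_act1 actP) // scale1r.
- rewrite (uea_act_iota actP) //; have [y [z xE]] := borel_decomp x.
  rewrite (borel_charE mu xE) xE -[lsval y]scale1r (lie_action_linl actP) //.
  by rewrite scale1r n0_cart n0_pos ?addr0 //; apply: valP.
- rewrite -[ueval _ s]scale1r (uea_act_linl actP) // scale1r Hs Ht.
  by rewrite scalerDl.
- by rewrite (uea_actM actP) // Ht (uea_actZ actP) // Hs scalerA mulrC.
- rewrite -[_ *: ueval _ s]addr0 (uea_act_linl actP) // Hs scalerA.
  by rewrite -[0]/(upi (UZero g)) (uea_act_upi actP) // addr0.
Qed.

Lemma tterm_lift_eq s t : teq (@uea_rmul K g td) (@char_lmul K g td mu) s t ->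
  tterm_lift s = tterm_lift t.
Proof.
elim=> {s t} /=.
- by [].
- by [].
- by move=> s t r _ -> _ ->.
- by move=> s s' t t' _ -> _ ->.
- by move=> a s s' _ ->.
- by move=> s t r; rewrite addrA.
- by move=> s t; rewrite addrC.
- by move=> s; rewrite add0r.
- by move=> s; rewrite scaleN1r subrr.
- by move=> a b s; rewrite scalerA.
- by move=> s; rewrite scale1r.
- by move=> a s t; rewrite scalerDr.
- by move=> a b s; rewrite scalerDl.
- move=> a x x' y; rewrite (uea_act_linl actP) // scalerDr !scalerA.
  by rewrite mulrC.
- by move=> a x y y'; rewrite scalerDl scalerA.
- move=> x a y; rewrite /uea_rmul (uea_actM actP) // borel_act.
  by rewrite (uea_actZ actP) // scalerA mulrC.
Qed.

Definition verma_lift (v : M) : W := tterm_lift (repr v).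

Lemma verma_lift_tpi s : verma_lift (tpi _ _ s) = tterm_lift s.
Proof. exact/tterm_lift_eq/teq_repr. Qed.

Lemma verma_lift_hw : verma_lift verma_hw = n0.
Proof. by rewrite verma_lift_tpi /= scale1r (uea_act1 actP). Qed.

Lemma verma_lift_lin : lin_maps verma_lift.
Proof.
move=> a u v; elim/tensor_ind: u => s; elim/tensor_ind: v => t.
by rewrite tpiZ tpiD !verma_lift_tpi.
Qed.

Lemma verma_lift_stable v : P (verma_lift v).
Proof.
have subP := lie_action_sub actP.
elim/tensor_ind: v => s; rewrite verma_lift_tpi.
elim: s => [|u z|s Hs t Ht|a s Hs] /=; first exact: subP.1.
- by apply: subspaceZ => //; apply: uea_act_stable.
- exact: subspaceD.
- exact: subspaceZ.
Qed.

Lemma verma_lift_act x v : verma_lift (lact x v) = act x (verma_lift v).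
Proof.
have subP := lie_action_sub actP.
have Z a w : P w -> act x (a *: w) = a *: act x w by apply: lie_action_Z.
elim/tensor_ind_pure: v => [|u z|u v Hu Hv|a u Hu].
- rewrite lact0r (lin_map0 verma_lift_lin).
  by have := Z 0 n0 Pn0; rewrite !scale0r.
- rewrite [lact _ _]verma_actE !verma_lift_tpi /= (uea_actM actP) //.
  by rewrite (uea_act_iota actP) ?Z //; apply: uea_act_stable.
- rewrite lactDr !(lin_mapD verma_lift_lin) Hu Hv -[verma_lift u]scale1r.
  by rewrite (lie_action_linr actP) ?scale1r //; apply: verma_lift_stable.
- rewrite lactZr !(lin_mapZ verma_lift_lin) Hu Z //.
  exact: verma_lift_stable.
Qed.

End Lift.

(** Balancing carries [b] from the factor 1 across the tensor sign to C_mu. *)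
Lemma verma_hw_borel (b : borel td) :
  lact (lsval b) verma_hw = (borel_char mu b : K) *: verma_hw.
Proof.
have hom : lie_hom_alg (fun x : borel td => uiota (lsval x)).
  by split=> *; rewrite ?(uiota_lie g).1 ?(uiota_lie g).2.
have := tpure_bal (@uea_rmul K g td) (@char_lmul K g td mu) 1 (uiota b) 1.
rewrite /uea_rmul /char_lmul !ulift_iota //; last exact: borel_char_lie.
by rewrite mul1r [lact _ _]verma_actE mulr1 tpureZr => ->.
Qed.

Lemma verma_hw_cart (y : h) : lact (lsval y) verma_hw = mu y *: verma_hw.
Proof.
have bx : lsval y \in borel td.
  apply/asboolP; exists (lsval y); first exact: valP.
  by exists 0; rewrite ?addr0 //; apply: (lie_pred_submod np).1.
rewrite (verma_hw_borel (LSub bx)) (@borel_charE _ _ _ mu y 0) //=.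
by rewrite addr0.
Qed.

End VermaUniversal.

(** * U(n_-) as a [g]-module, and linear forms on M(mu) *)

(* [g] acts on U(n_-): the map u |-> (x |-> x . u) has to be the n_--linear
   map U(n_-) -> Hom(g, U(n_-)) with prescribed value [top_map] at 1, where n_-
   acts on Hom(g, U(n_-)) through [g] (adjointly) and U(n_-).  This replaces
   the Poincare-Birkhoff-Witt theorem. *)
Section NegativeModel.
Context (K : fieldType) (g : lieAlgType K) (td : triangular g).
Context (mu : dual (tri_cart td)).
Let nm := tri_neg td.
Let h := tri_cart td.
Let np := tri_pos td.
Local Notation V := (uea nm).

(** The formula is dictated by x . (y u) = y (x . u) + [x, y] . u, read with f(x) = x . u. *)
Definition hom_act (y : nm) (f : g -> V) : g -> V :=
  fun x => uiota y * f x + f [< x, lsval y >].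

Lemma hom_action : lie_action (@lin_maps K g V) hom_act.
Proof.
split.
- exact: lin_maps_subspace.
- move=> y f fl a u v; rewrite /hom_act lieb_linl !fl mulrDr -scalerAr.
  by rewrite scalerDr addrACA.
- move=> a y z f fl; apply/funext => x; rewrite /hom_act /=.
  rewrite (uiota_lie nm).1 mulrDl -scalerAl lieb_linr fl.
  by rewrite [RHS](_ : _ = a *: (uiota y * f x + f [< x, lsval y >]) +
    (uiota z * f x + f [< x, lsval z >])) // scalerDr addrACA.
- move=> a y f1 f2 _ _; apply/funext => x; rewrite /hom_act.
  rewrite [LHS](_ : _ = uiota y * (a *: f1 x + f2 x) +
    (a *: f1 [< x, lsval y >] + f2 [< x, lsval y >])) //.
  rewrite [RHS](_ : _ = a *: (uiota y * f1 x + f1 [< x, lsval y >]) +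
    (uiota y * f2 x + f2 [< x, lsval y >])) //.
  by rewrite mulrDr -scalerAr scalerDr addrACA.
- move=> y z f fl; apply/funext => x; rewrite /hom_act /=.
  rewrite [RHS](_ : _ =
    uiota y * (uiota z * f x + f [< x, lsval z >]) +
     (uiota z * f [< x, lsval y >] + f [< [< x, lsval y >], lsval z >]) -
    (uiota z * (uiota y * f x + f [< x, lsval y >]) +
     (uiota y * f [< x, lsval z >] + f [< [< x, lsval z >], lsval y >]))) //.
  rewrite (uiota_lie nm).2 mulrBl !mulrDr !mulrA.
  have -> : [< x, [< lsval y, lsval z >] >] =
      [< [< x, lsval y >], lsval z >] - [< [< x, lsval z >], lsval y >].
    have /eqP := lieb_jacobi x (lsval y) (lsval z).
    rewrite (liebC (lsval z) x) liebNr (liebC (lsval z) [< x, lsval y >]).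
    rewrite -addrA addr_eq0 opprD !opprK => /eqP ->.
    by rewrite addrC (liebC (lsval y)).
  (* After regrouping, the mixed terms, with one generator outside [f] and one bracket inside,
     cancel. *)
  rewrite (lin_mapB fl) [X in _ = X - _](AC (2*2) ((1*4)*(2*3))).
  rewrite [X in _ = _ - X](AC (2*2) ((1*4)*(3*2))) [in RHS]opprD.
  by rewrite [RHS]addrACA subrr addr0 opprD addrACA.
Qed.

(** The intended value of x . 1: the n_- part acts as a generator, the Cartan part by [mu], the n_+
    part by 0. *)
Definition top_map : g -> V := fun x =>
  uiota (tri_dec td x).1.1 + mu (tri_dec td x).1.2 *: 1.

Lemma top_map_lin : lin_maps top_map.
Proof.
move=> a x y; rewrite /top_map tri_dec_lin /= (uiota_lie nm).1 dual_lin.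
by rewrite scalerDl scalerDr addrACA scalerA.
Qed.

Lemma top_map_neg (y : nm) : top_map (lsval y) = uiota y.
Proof.
rewrite /top_map (@tri_dec_uniq _ _ _ _ (y, 0, 0)) /=; last by rewrite !addr0.
by rewrite (lin_map0 (dual_lin_maps mu)) scale0r addr0.
Qed.

Lemma top_map_borel (b : borel td) : top_map (lsval b) = (borel_char mu b : K) *: 1.
Proof.
have [y [z bE]] := borel_decomp b; rewrite (borel_charE mu bE) /top_map.
rewrite (@tri_dec_uniq _ _ _ _ (0, y, z)) /=; last by rewrite bE add0r.
by rewrite [uiota 0](lin_map0 (uiota_lie nm).1) add0r.
Qed.

Definition neg_act (x : g) (u : V) : V := uea_act hom_act u top_map x.

Lemma neg_act_linl a x y u :
  neg_act (a *: x + y) u = a *: neg_act x u + neg_act y u.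
Proof. exact: (uea_act_stable hom_action u top_map_lin). Qed.

Lemma neg_act_linr a x u v :
  neg_act x (a *: u + v) = a *: neg_act x u + neg_act x v.
Proof. by rewrite /neg_act (uea_act_linl hom_action) //; apply: top_map_lin. Qed.

Lemma neg_act1 x : neg_act x 1 = top_map x.
Proof. by rewrite /neg_act (uea_act1 hom_action) //; apply: top_map_lin. Qed.

Lemma neg_act_mul x (y : nm) u :
  neg_act x (uiota y * u) = uiota y * neg_act x u + neg_act [< x, lsval y >] u.
Proof.
have tl := top_map_lin.
rewrite /neg_act (uea_actM hom_action) // (uea_act_iota hom_action) //.
exact: (uea_act_stable hom_action).
Qed.

(** By induction, [neg_act_mul] turns y . (z u) into z y u + [y, z] u, which is y z u in U(n_-). *)
Lemma neg_act_neg (y : nm) u : neg_act (lsval y) u = uiota y * u.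
Proof.
elim/uea_gen_ind: u y => [||a u v Hu Hv|z u Hu] y.
- have := neg_act_linr (-1) (lsval y) 0 0; rewrite scaler0 addr0 => ->.
  by rewrite scaleN1r addNr mulr0.
- by rewrite neg_act1 top_map_neg mulr1.
- by rewrite neg_act_linr Hu Hv mulrDr -scalerAr.
- rewrite neg_act_mul Hu -[[< _, _ >]]/(lsval [< y, z >]) Hu.
  by rewrite (uiota_lie nm).2 mulrBl !mulrA addrC subrK.
Qed.

Lemma neg_act_linl_maps u : @lin_maps K g V (neg_act^~ u).
Proof. by move=> a x y; apply: neg_act_linl. Qed.

Lemma neg_act_linr_maps x : @lin_maps K V V (neg_act x).
Proof. by move=> a u v; apply: neg_act_linr. Qed.

Lemma neg_borel_decomp x :
  exists n : nm, exists b : borel td, x = lsval n + lsval b.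
Proof.
have bP : lsval (tri_dec td x).1.2 + lsval (tri_dec td x).2 \in borel td.
  apply/asboolP; exists (lsval (tri_dec td x).1.2); first exact: valP.
  by exists (lsval (tri_dec td x).2); first exact: valP.
exists (tri_dec td x).1.1; exists (LSub bP).
by rewrite {1}(tri_decE td x) addrA.
Qed.

Let comm x y u :=
  neg_act [< x, y >] u = neg_act x (neg_act y u) - neg_act y (neg_act x u).

Let comm_sym x y u : comm x y u -> comm y x u.
Proof.
rewrite /comm => E; rewrite liebC [LHS](lin_mapN (neg_act_linl_maps u)) E.
by rewrite opprB.
Qed.

Let comm_add x x' y u : comm x y u -> comm x' y u -> comm (x + x') y u.
Proof.
have D w := lin_mapD (neg_act_linl_maps w).
rewrite /comm liebDl !D => -> ->.
by rewrite (lin_mapD (neg_act_linr_maps y)) opprD addrACA.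
Qed.

(** Since [n] acts by left multiplication, this is [neg_act_mul] rearranged. *)
Let comm_neg (n : nm) y u : comm (lsval n) y u.
Proof.
rewrite /comm liebC [neg_act (- _) _](lin_mapN (neg_act_linl_maps u)).
by rewrite !neg_act_neg neg_act_mul opprD addNKr.
Qed.

(** The n_- parts of [x] and [y] are covered by [comm_neg]. The remaining parts lie in the Borel
    subalgebra, which acts on 1 by scalars, and [borel_char] kills brackets. *)
Let comm_one x y : comm x y 1.
Proof.
have [n [b xE]] := neg_borel_decomp x; have [m [c yE]] := neg_borel_decomp y.
rewrite xE yE; apply: comm_add => //; apply: comm_sym; apply: comm_add => //.
apply: comm_sym; rewrite /comm !neg_act1.
rewrite -[[< lsval b, lsval c >]]/(lsval [< b, c >]) !top_map_borel.
rewrite !(lin_mapZ (neg_act_linr_maps _)) !neg_act1 !top_map_borel !scalerA.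
by rewrite -scalerBl (borel_char_lie mu).2 mulrC.
Qed.

Lemma neg_action : lie_action setT neg_act.
Proof.
split => //; first by move=> *; apply: neg_act_linl.
  by move=> *; apply: neg_act_linr.
move=> x y u _; elim/uea_gen_ind: u x y => [||a u v Hu Hv|z u Hu] x y.
- by rewrite !(lin_map0 (neg_act_linr_maps _)) subrr.
- exact: comm_one.
- by rewrite !neg_act_linr Hu Hv scalerBr opprD addrACA.
(* Moving z to the left turns the relation at z u into z times the one for x, y plus those for
   [x, z], y and x, [y, z], all at u. Hence x and y stay general in the induction. *)
- rewrite !neg_act_mul !(lin_mapD (neg_act_linr_maps _)) !neg_act_mul.
  have -> : [< [< x, y >], lsval z >] =
      [< [< x, lsval z >], y >] + [< x, [< y, lsval z >] >].
    have /eqP := lieb_jacobi x y (lsval z).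
    rewrite (liebC (lsval z) x) liebNr (liebC y [< x, _ >]) opprK.
    by rewrite (liebC (lsval z)) subr_eq0 addrC => /eqP <-.
  rewrite (lin_mapD (neg_act_linl_maps u)) !Hu mulrBr.
  rewrite [X in _ + X = _]addrACA [LHS]addrACA; congr (_ + _); first exact: addrA.
  by rewrite -!opprD [in RHS]addrAC addrA.
Qed.

Lemma neg_act1_pos x : x \in np -> neg_act x 1 = 0.
Proof.
move=> nx; rewrite neg_act1 /top_map (@tri_dec_uniq _ _ _ _ (0, 0, LSub nx)).
  rewrite /= (lin_map0 (dual_lin_maps mu)) scale0r addr0.
  exact: (lin_map0 (uiota_lie nm).1).
by rewrite /= !add0r.
Qed.

Lemma neg_act1_cart (y : h) : neg_act (lsval y) 1 = mu y *: 1.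
Proof.
rewrite neg_act1 /top_map (@tri_dec_uniq _ _ _ _ (0, y, 0)) /=.
  by rewrite [uiota 0](lin_map0 (uiota_lie nm).1) add0r.
by rewrite add0r addr0.
Qed.

(** The form is the [g]-map M(mu) -> U(n_-) sending the highest weight vector to 1, followed by the
    algebra morphism U(n_-) -> K extending [chi]. It works because n_- acts on U(n_-) by left
    multiplication. *)
Lemma verma_functional (chi : nm -> K) :
  (forall a x y, chi (a *: x + y) = a * chi x + chi y) ->
  (forall x y, chi [< x, y >] = 0) ->
  exists F : verma mu -> K^o, [/\ lin_maps F, F (verma_hw mu) = 1 &
    forall (y : nm) v, F (lact (lsval y) v) = chi y * F v].
Proof.
move=> chil chib; have chiP : lie_hom_alg (chi : nm -> K^o).
  by split=> // x y; rewrite chib [_ * _]mulrC subrr.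
pose psi : verma mu -> V := verma_lift neg_act 1.
have psiP := verma_lift_lin neg_action I neg_act1_pos neg_act1_cart.
exists (fun v => ulift (chi : nm -> K^o) (psi v)); split.
- by move=> a u v; rewrite /psi psiP ulift_lin.
- by rewrite /psi (verma_lift_hw neg_action I neg_act1_pos neg_act1_cart) ulift1.
- move=> y v.
  rewrite /psi (verma_lift_act neg_action I neg_act1_pos neg_act1_cart).
  by rewrite neg_act_neg uliftM // ulift_iota.
Qed.

End NegativeModel.

(** * Words in root vectors and the contravariant form *)

Section ContravariantForm.
Context (K : fieldType) (g : lieAlgType K) (td : triangular g).
Context (mu : dual (tri_cart td)) (sigma : g -> g).
Let nm := tri_neg td.
Let h := tri_cart td.
Let np := tri_pos td.
Local Notation M := (verma mu).
Local Notation hw := (verma_hw mu).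

Record tri_involution : Prop := TriInvolution {
  tri_inv_lin : lin_maps sigma;
  tri_invK : involutive sigma;
  tri_inv_lieb : forall x y, sigma [< x, y >] = [< sigma y, sigma x >];
  tri_inv_pos : forall x, x \in np -> sigma x \in nm;
  tri_inv_neg : forall x, x \in nm -> sigma x \in np;
  tri_inv_cart : forall y : h, sigma (lsval y) = lsval y
}.

Context (sigmaP : tri_involution).

Section Words.
Context (letter : dual h -> g -> Prop).
Context (letter_root : forall alpha x, letter alpha x ->
  root_space np alpha x).
Context (letter_span : forall x, x \in np ->
  lin_span [set x | exists alpha, letter alpha x] x).

(* [neg_word beta] : the vectors sigma x_1 ... sigma x_k . hw, with x_i a letter
   of weight alpha_i and beta = alpha_1 + ... + alpha_k. *)
Inductive neg_word : dual h -> M -> Prop :=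
| NegWordHw : neg_word 0 hw
| NegWordCons alpha x beta m : letter alpha x -> neg_word beta m ->
    neg_word (alpha + beta) (lact (sigma x) m).

Lemma neg_word_weight beta m : neg_word beta m -> weight_space (mu - beta) m.
Proof.
elim=> [|alpha x b v lx _ wv]; first by rewrite subr0; apply: verma_hw_cart.
rewrite opprD addrCA; apply: lact_weight wv => y.
(* As sigma fixes h and reverses brackets, [y, sigma x] = sigma [x, y], so sigma x has weight
   -alpha. *)
have [_ wx] := letter_root lx; rewrite -(tri_inv_cart sigmaP y).
rewrite -(tri_inv_lieb sigmaP) liebC wx dualNE -scaleNr.
exact: (lin_mapZ (tri_inv_lin sigmaP)).
Qed.

(** The span of the words contains the highest weight vector, so it suffices that [g] preserves it.
    For n_- this holds because images of letters span n_-; an arbitrary [z] is commuted past the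
    first letter, by induction on the word with [z] general. *)
Lemma neg_word_span v : lin_span [set m | exists beta, neg_word beta m] v.
Proof.
set T := lin_span _; have subT : subspace T by apply: lin_span_subspace.
have wT beta m : neg_word beta m -> T m.
  by move=> wm; apply: lin_span_gen; exists beta.
have negT y m : y \in nm -> T m -> T (lact y m).
  move=> ny [s sT ->]; rewrite lact_sumr; apply: subspace_sum => // p /sT[b wp].
  rewrite lactZr; apply: subspaceZ => //.
  have [t tl yE] := letter_span (tri_inv_neg sigmaP ny).
  rewrite -(tri_invK sigmaP y) yE (lin_map_sum (tri_inv_lin sigmaP)) lact_suml.
  apply: subspace_sum => // q /tl[a la].
  rewrite (lin_mapZ (tri_inv_lin sigmaP)) lactZl; apply: subspaceZ => //.
  by apply: (wT (a + b)); apply: NegWordCons.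
have wordT z beta m : neg_word beta m -> T (lact z m).
  move=> wm; elim: wm z => [|alpha x b v' lx wv IH] z.
    have [n [b ->]] := neg_borel_decomp td z; rewrite lactDl verma_hw_borel.
    apply: subspaceD => //; last by apply: subspaceZ => //; apply: (wT 0); constructor.
    by apply: negT; [apply: valP | apply: (wT 0); constructor].
  have [nx _] := letter_root lx.
  have -> : lact z (lact (sigma x) v') =
      lact (sigma x) (lact z v') + lact [< z, sigma x >] v'.
    by rewrite lact_lieb addrC subrK.
  by apply: subspaceD => //; apply: negT => //; apply: tri_inv_pos.
elim/verma_gen_ind: v => [|||x v [s sT ->]].
- exact: subT.1.
- exact: (wT _ _ NegWordHw).
- exact: subT.2.
- rewrite lact_sumr; apply: subspace_sum => // p /sT[b wp].
  by rewrite lactZr; apply: subspaceZ => //; apply: wordT wp.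
Qed.

Lemma neg_word_eq (U : lmodType K) (F G : M -> U) : lin_maps F -> lin_maps G ->
  (forall beta m, neg_word beta m -> F m = G m) -> F =1 G.
Proof.
move=> Fl Gl FG v; have [s sT ->] := neg_word_span v.
rewrite (lin_map_sum Fl) (lin_map_sum Gl); apply: eq_big_seq => p /sT[b /FG E].
by rewrite (lin_mapZ Fl) (lin_mapZ Gl) E.
Qed.

End Words.

(** Symmetry is not among the fields, so nondegeneracy is asked on each side: the left one separates
    vectors, the right one serves to represent linear forms. *)
Record contravariant_form (B : M -> M -> K) : Prop := ContravariantForm {
  form_linl : forall m, @lin_maps K M K^o (B^~ m);
  form_linr : forall m, @lin_maps K M K^o (B m);
  form_contra : forall x m m', B (lact x m) m' = B m (lact (sigma x) m');
  form_hw : B hw hw = 1;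
  form_nondegl : forall m, (forall m', B m m' = 0) -> m = 0;
  form_nondegr : forall m, (forall m', B m' m = 0) -> m = 0
}.

Lemma form_scalel B : contravariant_form B -> forall a m m',
  B (a *: m) m' = a * B m m'.
Proof. by move=> BP a m m'; apply: (lin_mapZ (form_linl BP m')). Qed.

Lemma form_scaler B : contravariant_form B -> forall a m m',
  B m (a *: m') = a * B m m'.
Proof. by move=> BP a m m'; apply: (lin_mapZ (form_linr BP m)). Qed.

(** Elements of h are fixed by sigma, hence self-adjoint for [B]. *)
Lemma form_weight B : contravariant_form B -> forall nu nu' m m',
  @weight_space K g td M nu m -> @weight_space K g td M nu' m' -> nu <> nu' -> B m m' = 0.
Proof.
move=> BP nu nu' m m' wm wm' nn.
have [y yE] : exists y : h, (nu y : K) != nu' y.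
  apply: contrapT => /forallNP E; apply: nn; apply: dualP => y; apply/eqP.
  by have := E y => /negP; rewrite negbK.
have := form_contra BP (lsval y) m m'.
rewrite (tri_inv_cart sigmaP) wm wm' (form_scalel BP) (form_scaler BP) => /eqP.
by rewrite -subr_eq0 -mulrBl mulf_eq0 subr_eq0 (negPf yE) => /eqP.
Qed.

Definition dual_act (x : g) (psi : M -> K^o) : M -> K^o :=
  fun m => psi (lact (sigma x) m).

Lemma dual_action : lie_action (@lin_maps K M K^o) dual_act.
Proof.
split.
- exact: lin_maps_subspace.
- by move=> x f fl a u v; rewrite /dual_act lactDr lactZr fl.
- move=> a x y f fl; apply/funext => m; rewrite /dual_act.
  by rewrite (tri_inv_lin sigmaP) lactDl lactZl fl.
- by [].
- move=> x y f fl; apply/funext => m; rewrite /dual_act.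
  by rewrite (tri_inv_lieb sigmaP) lact_lieb (lin_mapB fl).
Qed.

(** Meant for the two radicals of the form, which miss the highest weight vector because the form is
    1 on it. *)
Lemma simple_verma_sub (X : set M) : simple_module [set: g] [set: M] ->
  submodule [set: g] X -> ~ X hw -> forall m, X m -> m = 0.
Proof.
move=> [_ _ simple] subX Xhw m Xm.
have [X0|XT] := simple X subX (fun _ _ => I); last by case: Xhw; rewrite XT.
by rewrite X0 in Xm.
Qed.

Lemma contravariant_form_exists : simple_module [set: g] [set: M] ->
  exists B, contravariant_form B.
Proof.
move=> simple.
(* The zero character of n_- yields the coordinate form [p]: 1 at the highest weight vector, 0 on
   n_- M(mu). *)
have chi0l a x y : (fun _ : nm => 0 : K) (a *: x + y) =
    a * (fun _ : nm => 0 : K) x + (fun _ : nm => 0 : K) y.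
  by rewrite mulr0 addr0.
have [p [plin phw pneg]] := verma_functional mu chi0l (fun _ _ => erefl).
have pneg0 y m : y \in nm -> p (lact y m) = 0.
  by move=> ny; rewrite (pneg (LSub ny)) mul0r.
have actP := dual_action.
have p_pos x : x \in np -> dual_act x p = 0.
  by move=> nx; apply/funext => m; apply: pneg0; apply: (tri_inv_pos sigmaP).
(* Checked on words. On a nonempty word both sides vanish, as commuting [y] past the first letter
   leaves only vectors of n_- M(mu). *)
have p_cart (y : h) : dual_act (lsval y) p = mu y *: p.
  apply/funext => m; rewrite /dual_act (tri_inv_cart sigmaP).
  rewrite [RHS](_ : _ = mu y * p m) //.
  pose letter (a : dual h) (x : g) := root_space np a x.
  have ls x : x \in np -> lin_span [set x | exists a, letter a x] x.
    move=> nx; have [D [_ [_ dec _] _]] := tri_roots td.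
    have [s sr ->] := dec _ nx; apply: subspace_sum => [|q /sr rq].
      exact: lin_span_subspace.
    by apply: lin_span_gen; exists q.1.
  move: m; apply: (neg_word_eq (letter := letter)) => //.
  - by move=> a u v; rewrite lactDr lactZr plin.
  - by move=> a u v; rewrite plin mulrDr; congr (_ + _); apply: mulrCA.
  - move=> _ _ [|a x b m lx _].
      by rewrite verma_hw_cart (lin_mapZ plin) phw.
    have nx : sigma x \in nm by apply: (tri_inv_pos sigmaP); case: lx.
    rewrite [in RHS]pneg0 // mulr0.
    have -> : lact (lsval y) (lact (sigma x) m) =
        lact (sigma x) (lact (lsval y) m) + lact [< lsval y, sigma x >] m.
      by rewrite lact_lieb addrC subrK.
    rewrite (lin_mapD plin) !pneg0 ?addr0 //.
    by apply: tri_neg_stable => //; apply: valP.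
pose B (m m' : M) : K := verma_lift dual_act p m m'.
have Bl m : @lin_maps K M K^o (B^~ m).
  by move=> a u v; rewrite /B (verma_lift_lin actP plin p_pos p_cart).
have Br m : @lin_maps K M K^o (B m) := verma_lift_stable actP plin p_pos p_cart m.
have Bs x m m' : B (lact x m) m' = B m (lact (sigma x) m').
  by rewrite /B (verma_lift_act actP plin p_pos p_cart).
have Bhw m : B hw m = p m.
  by rewrite /B (verma_lift_hw actP plin p_pos p_cart).
exists B; split => //.
- by rewrite Bhw.
- apply: (simple_verma_sub simple) => /=.
    split=> [|x m _ Bm m']; last by rewrite Bs.
    split=> [m'|a u v Bu Bv m']; first by rewrite (lin_map0 (Bl m')).
    by rewrite (Bl m') Bu Bv scaler0 addr0.
  by move=> /(_ hw); rewrite Bhw phw => /eqP; rewrite oner_eq0.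
- apply: (simple_verma_sub simple) => /=.
    split=> [|x m _ Bm m']; last first.
      by rewrite -[x](tri_invK sigmaP) -Bs.
    split=> [m'|a u v Bu Bv m']; first by rewrite (lin_map0 (Br m')).
    by rewrite (Br m') Bu Bv scaler0 addr0.
  by move=> /(_ hw); rewrite Bhw phw => /eqP; rewrite oner_eq0.
Qed.

End ContravariantForm.

(** * Finiteness of the set of words of a given weight *)

Section FinitelyManyWords.
Context (K : fieldType) (char0 : [pchar K] =i pred0).

(** Independence determines the multiplicities as elements of [K]; in characteristic zero these
    determine the natural numbers. *)
Lemma lin_indep_perm (V : lmodType K) (D : set V) (s t : seq V) :
  lin_indep D -> (forall v, v \in s -> D v) -> (forall v, v \in t -> D v) ->
  \sum_(v <- s) v = \sum_(v <- t) v -> perm_eq s t.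
Proof.
move=> indD sD tD st; pose r := undup (s ++ t).
have count_sum (u : seq V) : {subset u <= r} ->
    \sum_(v <- u) v = \sum_(v <- r) (count_mem v u)%:R *: v.
  elim: u => [_|x u IH ur].
    by rewrite big_nil big1 // => v _; rewrite scale0r.
  rewrite big_cons IH => [|v vu]; last by rewrite ur // inE vu orbT.
  have xr : x \in r by rewrite ur // mem_head.
  rewrite [RHS](eq_bigr (fun v => (x == v)%:R *: v + (count_mem v u)%:R *: v)).
    rewrite big_split [X in _ = X + _](bigD1_seq x) ?undup_uniq //= eqxx scale1r.
    congr (_ + _).
    by rewrite big1 ?addr0 // => v; rewrite eq_sym => /negPf ->; rewrite scale0r.
  by move=> v _; rewrite -scalerDl -natrD.
have c0 : forall v, v \in r -> (count_mem v s)%:R - (count_mem v t)%:R = 0 :> K.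
  apply: indD; first exact: undup_uniq.
    by move=> v; rewrite mem_undup mem_cat => /orP[/sD|/tD].
  under eq_bigr do rewrite scalerBl.
  rewrite sumrB -!count_sum ?st ?subrr // => v vu;
    by rewrite mem_undup mem_cat vu ?orbT.
apply/allP => v vst; apply/eqP.
have /c0/eqP : v \in r by rewrite mem_undup.
rewrite subr_eq0 /= => /eqP E; apply/eqP; move: E.
wlog le_ts : s t {st r count_sum c0 vst sD tD} / (count_mem v t <= count_mem v s)%N.
  move=> H; case: (leqP (count_mem v t) (count_mem v s)) => [/H//|/ltnW ts E].
  by rewrite eq_sym; apply: H.
move=> /eqP; rewrite -subr_eq0 -natrB // ((pcharf0P K).1 char0) subn_eq0.
by rewrite eqn_leq le_ts andbT.
Qed.

Lemma finite_dim_span (V : lmodType K) (X : set V) : finite_dim X ->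
  exists s : seq V, (forall v, v \in s -> X v) /\ X `<=` lin_span [set` s].
Proof.
move=> [n [S [_ SX] cardS]].
have /finite_seqP[s sE] : finite_set S by exists n.
exists s; split => [v vs|]; last by rewrite -sE SX.
by rewrite -SX; apply: lin_span_gen; rewrite sE.
Qed.

Context (g : lieAlgType K) (td : triangular g).
Context (mu : dual (tri_cart td)) (sigma : g -> g).
Let h := tri_cart td.
Let np := tri_pos td.
(** The second clause makes [alpha] a root whatever [e] is, hence a nonzero element of the monoid
    over the independent set. This is what bounds the length of words. *)
Definition root_letter (e : dual h -> seq g) alpha x :=
  x \in e alpha /\ root_space np alpha <> [set 0].

Context (root_finite : forall alpha : dual h, finite_dim (root_space np alpha)).

Lemma finite_letters : exists e : dual h -> seq g,
  (forall alpha x, root_letter e alpha x -> root_space np alpha x) /\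
  (forall x, x \in np -> lin_span [set x | exists alpha, root_letter e alpha x] x).
Proof.
have [e eP] := choice (fun a => finite_dim_span (root_finite a)).
exists e; split=> [a x [/(eP a).1 //]|x nx].
have [D [_ [_ dec _] _]] := tri_roots td.
have subT : subspace (lin_span [set x | exists alpha, root_letter e alpha x]).
  exact: lin_span_subspace.
have [s sr ->] := dec _ nx; apply: subspace_sum => // p /sr rp.
have [p0|pn0] := pselect (root_space np p.1 = [set 0]).
  by move: rp; rewrite p0 => ->; apply: subT.1.
apply: (lin_span_sub subT (S := [set` e p.1])); last exact: (eP p.1).2.
by move=> y ye; apply: lin_span_gen; exists p.1.
Qed.

(** [beta] is the sum of an essentially unique multiset [s0] of elements of [D]. Each letter
    consumes a nonempty part of it, which bounds the number of letters and leaves finitely many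
    weights for them. *)
Lemma neg_word_finite (e : dual h -> seq g) beta :
  exists L : seq (verma mu), forall m,
    neg_word sigma (root_letter e) beta m -> m \in L.
Proof.
have [D [indD _ rootD]] := tri_roots td.
have wordD b (m : verma mu) : neg_word sigma (root_letter e) b m -> add_monoid D b.
  elim=> [|a x {}b v [_ /rootD[[s sD ->] _]] _ [t tD ->]].
    by exists [::]; rewrite ?big_nil.
  exists (s ++ t); last by rewrite big_cat.
  by move=> d; rewrite mem_cat => /orP[/sD|/tD].
have [[s0 s0D s0E]|bD] := pselect (add_monoid D beta); last first.
  by exists [::] => m /wordD.
(* Sums of sub-multisets of [s0], obtained as prefixes of its permutations. *)
pose roots := [seq \sum_(d <- take k p) d |
  p <- permutations s0, k <- iota 0 (size s0).+1].
pose letters := flatten [seq e a | a <- roots].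
pose L := fix L n : seq (verma mu) := verma_hw mu :: if n is n'.+1 then
  [seq lact (sigma x) m | x <- letters, m <- L n'] else [::].
exists (L (size s0)) => m wm.
(* In the induction on the word, [t] is the part of [s0] still to be spent, [r] the part already
   spent, and [n] bounds the letters left. *)
suff H n t r : (size t <= n)%N -> (forall d, d \in t -> D d) ->
    beta = \sum_(d <- t) d -> perm_eq (t ++ r) s0 -> m \in L n.
  by apply: (H (size s0) s0 [::]) => //; rewrite cats0.
elim: wm n t r {s0E} => [[|n] *|a x b v [xe /rootD[[s sD aE] a0]] wv IH n t r tn tD tE p].
- exact: mem_head.
- exact: mem_head.
have [t' t'D bE] := wordD _ _ wv.
have pt : perm_eq (s ++ t') t.
  apply: (lin_indep_perm indD) => //; last by rewrite big_cat -tE aE bE.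
  by move=> d; rewrite mem_cat => /orP[/sD|/t'D].
have ps : perm_eq (s ++ (t' ++ r)) s0.
  by rewrite catA; apply: perm_trans p; rewrite perm_cat2r.
(* The root [a] is nonzero, so its letter consumes something and the bound [n] can drop. *)
have s_gt0 : (0 < size s)%N.
  by case: (s) aE => // aE; case: a0; rewrite aE big_nil.
have le_t : (size s + size t' <= n)%N by rewrite -size_cat (perm_size pt).
case: n tn le_t => [|n] tn le_t.
  by move: le_t; rewrite leqn0 addn_eq0 -leqn0 leqNgt s_gt0.
rewrite inE; apply/orP; right; apply/allpairsP; exists (x, v); split => //=.
  apply/flattenP; exists (e a) => //; apply: map_f; rewrite aE.
  apply/allpairsP; exists (s ++ (t' ++ r), size s); split.
  - by rewrite mem_permutations.
  - rewrite mem_iota add0n ltnS -(perm_size ps) size_cat.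
    exact: leq_addr.
  - by rewrite /= take_size_cat.
apply: (IH n t' (r ++ s)) => //.
  by rewrite -ltnS; apply: leq_trans le_t; rewrite -addn1 addnC leq_add2r.
by rewrite catA perm_catC.
Qed.

End FinitelyManyWords.

(** * Existence and uniqueness of the Whittaker vector *)

Section WhittakerVectors.
Context (K : fieldType) (char0 : [pchar K] =i pred0).
Context (g : lieAlgType K) (td : triangular g).
Let nm := tri_neg td.
Let h := tri_cart td.
Let np := tri_pos td.

(** The list may be linearly dependent, so the Gram matrix need not be invertible. The system is
    still solvable because the values of [F] satisfy every relation among its columns. *)
Lemma gram_solve (V : lmodType K) (B : V -> V -> K) (F : V -> K) (L : seq V) :
  (forall m, @lin_maps K V K^o (B^~ m)) -> (forall m, @lin_maps K V K^o (B m)) ->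
  @lin_maps K V K^o F ->
  (forall m, lin_span [set` L] m -> (forall m', m' \in L -> B m' m = 0) -> m = 0) ->
  exists2 w, lin_span [set` L] w & forall m, m \in L -> B w m = F m.
Proof.
move=> Bl Br Fl nondeg; pose n := size L; pose l (i : 'I_n) := L`_i.
have lL i : l i \in L by apply: mem_nth.
have comb (c : 'I_n -> K) : lin_span [set` L] (\sum_i c i *: l i).
  apply: subspace_sum => [|i _]; first exact: lin_span_subspace.
  by apply: subspaceZ; [apply: lin_span_subspace | apply: lin_span_gen; apply: lL].
pose A := \matrix_(i < n, j < n) B (l i) (l j).
pose f := \row_(j < n) F (l j).
have /submxP[c cE] : (f <= A)%MS.
  rewrite submxE; apply/eqP/rowP => j; rewrite [LHS]mxE [RHS]mxE.
  (* A column of the cokernel matrix is a column relation of [A]; the vector [a] it defines is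
     orthogonal to all of [L], hence zero, so [F] vanishes on it. *)
  pose a := \sum_k cokermx A k j *: l k.
  have a0 : a = 0.
    apply: nondeg => [|m' /(nthP 0)[i ilt <-]]; first exact: comb.
    rewrite (lin_map_sum (Br _)).
    have /matrixP/(_ (Ordinal ilt) j) := mulmx_coker A.
    rewrite [in LHS]mxE [in RHS]mxE => A0.
    transitivity (\sum_k A (Ordinal ilt) k * cokermx A k j); last exact: A0.
    by apply: eq_bigr => k _; rewrite (lin_mapZ (Br _)) [A _ _]mxE mulrC.
  transitivity (F a); last by rewrite a0 (lin_map0 Fl).
  rewrite (lin_map_sum Fl); apply: eq_bigr => k _.
  by rewrite (lin_mapZ Fl) [f _ _]mxE mulrC.
exists (\sum_i c 0 i *: l i) => [|m /(nthP 0)[j jlt <-]]; first exact: comb.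
have /rowP/(_ (Ordinal jlt)) := cE; rewrite [LHS]mxE [RHS]mxE => ->.
rewrite (lin_map_sum (Bl _)); apply: eq_bigr => k _.
by rewrite (lin_mapZ (Bl _)) [A _ _]mxE.
Qed.

Lemma tri_involution_exists : exists sigma, @tri_involution K g td sigma.
Proof.
have [sigma [sl si sa sn sh]] := tri_sigma td; exists sigma.
have pos x : x \in np -> sigma x \in nm.
  move=> nx; have : (sigma @` [set` np]) (sigma x) by exists x.
  by rewrite sn.
split=> // [x nx|y]; last exact/sh/valP.
have : [set` nm] x by [].
by rewrite -sn => -[y ny <-]; rewrite si.
Qed.

Context (mu : dual h) (lambda : dual np) (lambda_char : lie_character lambda).
Context (root_finite : forall alpha : dual h, finite_dim (root_space np alpha)).
Local Notation M := (verma mu).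
Local Notation hw := (verma_hw mu).

Lemma whittaker_functional (sigma : g -> g) (sigmaP : tri_involution td sigma) :
  exists F : M -> K^o, [/\ lin_maps F, F hw = 1 &
    forall (x : np) v, F (lact (sigma (lsval x)) v) = lambda x * F v].
Proof.
(* The character lambda transported to n_- by sigma. *)
pose chi (y : nm) : K := lambda (LSub (tri_inv_neg sigmaP (valP y))).
have chil a x y : chi (a *: x + y) = a * chi x + chi y.
  rewrite /chi -dual_lin; congr (lambda _); apply: val_inj => /=.
  exact: (tri_inv_lin sigmaP).
have chib x y : chi [< x, y >] = 0.
  rewrite -[RHS](lambda_char (LSub (tri_inv_neg sigmaP (valP y)))
                             (LSub (tri_inv_neg sigmaP (valP x)))).
  congr (lambda _); apply: val_inj => /=.
  exact: (tri_inv_lieb sigmaP).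
have [F [Fl Fhw Fneg]] := verma_functional mu chil chib.
exists F; split=> // x v.
rewrite (Fneg (LSub (tri_inv_pos sigmaP (valP x)))); congr (lambda _ * _).
by apply: val_inj => /=; rewrite (tri_invK sigmaP).
Qed.

Lemma whittaker_generator : simple_module [set: g] [set: M] ->
  exists w0 : completion td M, [/\ w0 <> 0, whittaker lambda w0 &
    forall w, whittaker lambda w -> exists c : K, w = c *: w0].
Proof.
move=> simple; have [sigma sigmaP] := tri_involution_exists.
have [B BP] := contravariant_form_exists sigmaP simple.
have [F [Fl Fhw Fsigma]] := whittaker_functional sigmaP.
have [e [lroot lspan]] := finite_letters root_finite.
pose word := @neg_word K g td mu sigma (root_letter e).
have Fword x m (nx : x \in np) : F (lact (sigma x) m) = lambda (LSub nx) * F m.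
  exact: (Fsigma (LSub nx)).
have wweight nu m : word (mu - nu) m -> weight_space nu m.
  by move=> /(neg_word_weight sigmaP lroot); rewrite opprB addrC subrK.
have word_ext (G G' : M -> K^o) : lin_maps G -> lin_maps G' ->
    (forall b m, word b m -> G m = G' m) -> G =1 G'.
  exact: (neg_word_eq sigmaP lroot lspan).
have zl : @lin_maps K M K^o (fun _ => 0) by move=> a u v; rewrite scaler0 addr0.
have ortho nu b m m' : weight_space nu m -> word b m' -> b <> mu - nu ->
    B m m' = 0 /\ B m' m = 0.
  move=> wm /(neg_word_weight sigmaP lroot) wm' bn.
  have nn : nu <> mu - b by move=> E; apply: bn; rewrite E opprB addrC subrK.
  split; first exact: (form_weight sigmaP BP wm wm').
  by apply: (form_weight sigmaP BP wm' wm) => E; apply: nn.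
(* Words of any other weight are orthogonal to both vectors, so left nondegeneracy only has to be
   tested on words of weight [nu]. *)
have ext nu u v : weight_space nu u -> weight_space nu v ->
    (forall m, word (mu - nu) m -> B u m = B v m) -> u = v.
  move=> wu wv uv; apply/eqP; rewrite -subr_eq0; apply/eqP.
  apply: (form_nondegl BP) => m'.
  rewrite (lin_mapB (form_linl BP m')); apply/eqP; rewrite subr_eq0; apply/eqP.
  move: m'; apply: word_ext; [exact: (form_linr BP)|exact: (form_linr BP)|].
  move=> b m wm; have [bE|bn] := pselect (b = mu - nu); first by apply: uv; rewrite -bE.
  by rewrite (ortho nu b u m wu wm bn).1 (ortho nu b v m wv wm bn).1.
(* The component of weight [nu] represents the restriction of [F] to that weight space, found by
   solving a Gram system on the finitely many words there. *)
have /choice[w0 w0P] nu : exists w, weight_space nu w /\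
    forall m, word (mu - nu) m -> B w m = F m.
  have [L0 L0P] := neg_word_finite char0 mu sigma e (mu - nu).
  pose L := [seq m <- L0 | `[< word (mu - nu) m >]].
  have LP m : m \in L <-> word (mu - nu) m.
    rewrite mem_filter; split=> [/andP[/asboolP]//|wm].
    by rewrite (L0P _ wm) andbT; apply/asboolP.
  have weightL : lin_span [set` L] `<=` weight_space nu.
    apply: lin_span_sub => [|m /LP/wweight//].
    split; [exact: weight_space0 | move=> a u v; exact: weight_space_lin].
  have [m mL B0|w wL wF] := gram_solve (form_linl BP) (form_linr BP) Fl (L := L).
    apply: (form_nondegr BP); apply: word_ext => //; first exact: (form_linl BP).
    move=> b m' wm'; have [bE|bn] := pselect (b = mu - nu).
      by apply: B0; apply/LP; rewrite -bE.
    by rewrite (ortho nu b m m' (weightL _ mL) wm' bn).2.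
  by exists w; split; [exact: weightL | move=> m /LP/wF].
have w0C : (w0 : dual h -> M) \in completion_pred (td := td) (M := M).
  by apply/asboolP => nu; have [] := w0P nu.
pose W0 : completion td M := Completion w0C.
have W0E nu : W0 nu = w0 nu by [].
(* A root vector is its own weight decomposition, with a single term. *)
have act_root (w : completion td M) a x nu : root_space np a x ->
    lact x w nu = lact x (w (nu - a)).
  move=> [_ wx]; rewrite [LHS](@completion_actE _ _ _ M [:: (a, x)]).
  - by rewrite /seq_act big_seq1.
  - by move=> p; rewrite inE => /eqP ->.
  - by rewrite big_seq1.
exists W0; split.
- move=> W00; have : B (W0 mu) hw = 0.
    by rewrite W00 (lin_map0 (form_linl BP hw)).
  rewrite W0E (w0P mu).2; last by rewrite subrr; apply: NegWordHw.
  by rewrite Fhw => /eqP; rewrite oner_eq0.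
(* Paired with a word m, x . w0 gives F(sigma x m) = lambda(x) F(m) by contravariance. *)
- have letterW a x (nx : x \in np) : root_letter e a x ->
      lact x W0 = lambda (LSub nx) *: W0.
    move=> lx; apply: completion_ext => nu; rewrite completionZE !W0E.
    rewrite (act_root _ _ _ _ (lroot _ _ lx)) W0E.
    have [wwa wFa] := w0P (nu - a); have [ww wF] := w0P nu.
    apply: (ext nu).
    + by have := lact_weight (lroot _ _ lx).2 wwa; rewrite addrCA subrr addr0.
    + rewrite -[_ *: _]addr0; apply: weight_space_lin => //.
      exact: weight_space0.
    + move=> m wm; rewrite (form_contra BP) (form_scalel BP) wF // wFa.
        exact: Fword.
      by rewrite opprB addrA [mu + a]addrC -addrA; apply: NegWordCons.
  (* The relation passes from letters to all of n_+ by linearity. Membership is quantified inside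
     [X] because [lambda] lives on the subtype. *)
  pose X : set g := [set x | exists nx : x \in np, lact x W0 = lambda (LSub nx) *: W0].
  have [np0 npl] := lie_pred_submod np.
  have subX : subspace X.
    split=> [|a x y [nx Wx] [ny Wy]].
      exists np0; rewrite lact0l (_ : LSub np0 = 0); last exact: val_inj.
      by rewrite (lin_map0 (dual_lin_maps lambda)) scale0r.
    exists (npl _ _ _ nx ny).
    rewrite lact_linl Wx Wy scalerA -scalerDl -dual_lin.
    by congr (lambda _ *: _); apply: val_inj.
  move=> x; have [|nx ->] := lin_span_sub subX _ (lspan _ (valP x)).
    by move=> y [a ly]; have [ny _] := lroot _ _ ly; exists ny; apply: letterW ly.
  by congr (lambda _ *: _); apply: val_inj.
(* Pairing [w] with words obeys the same recursion as [F], so [w] is fixed by its value at the empty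
   word, which is the constant chosen here. *)
- move=> w Ww; exists (B (w mu) hw); apply: completion_ext => nu.
  rewrite completionZE W0E; have [ww wF] := w0P nu.
  apply: (ext nu); first exact: completionP.
    rewrite -[_ *: _]addr0; apply: weight_space_lin => //.
    exact: weight_space0.
  move=> m wm; rewrite (form_scalel BP) wF //.
  (* Expresses the weight through the index of the word, so that the induction on the word varies
     both together. *)
  have -> : nu = mu - (mu - nu) by rewrite opprB addrC subrK.
  elim: wm => {m} [|a x b m lx wm IH]; first by rewrite subr0 Fhw mulr1.
  have nx : x \in np by case: (lroot _ _ lx).
  rewrite (Fword _ _ nx) mulrCA -IH -(form_contra BP) -(form_scalel BP).
  congr (B _ _); rewrite -completionZE -(Ww (LSub nx)).
  rewrite (act_root _ _ _ _ (lroot _ _ lx)).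
  by rewrite opprD addrA addrAC.
Qed.
End WhittakerVectors.

(** * Dimension and simplicity of a line, and the conclusion *)

Section Lines.
Context (K : fieldType) (V : lmodType K) (X : set V) (v0 : V).
Context (v0_neq0 : v0 <> 0) (Xv0 : X v0) (subX : subspace X).
Context (X_line : forall v, X v -> exists c : K, v = c *: v0).

Lemma line_has_dim : has_dim X 1.
Proof.
exists [set v0]; last by apply: card_set1.
split.
  move=> [|u s] c us sv sum0 v vs; first by [].
  have sE w : w \in u :: s -> w = v0 by move/sv.
  (* Every entry equals [v0], so uniqueness leaves a single one. *)
  have s0 : s = [::].
    case: s {sv sum0 vs} us sE => [//|w s] us sE.
    have := us; rewrite /= inE.
    by rewrite [u]sE ?mem_head // [w]sE ?inE ?eqxx ?orbT.
  move: sum0; rewrite s0 big_seq1 (sE v vs) -(sE u (mem_head _ _)) => /eqP.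
  rewrite scaler_eq0 => /orP[/eqP //|/eqP u0].
  by case: v0_neq0; rewrite -(sE u (mem_head _ _)).
apply/seteqP; split.
  by apply: lin_span_sub => // _ ->.
move=> v /X_line[c ->]; apply: subspaceZ; first exact: lin_span_subspace.
exact: lin_span_gen.
Qed.

End Lines.

(** A nonzero vector of a submodule is an invertible multiple of [v0], so the submodule contains the
    whole line. *)
Lemma line_simple (K : fieldType) (g : lieAlgType K) (V : lieModType g)
    (A : set g) (W : set V) (v0 : V) : v0 <> 0 -> W v0 -> submodule A W ->
  (forall v, W v -> exists c : K, v = c *: v0) -> simple_module A W.
Proof.
move=> v0_neq0 Wv0 subW W_line; split=> // [W0|X [subX _] XW].
  by move: Wv0; rewrite W0.
have [X0|/existsNP[v /not_implyP[Xv v0']]] := pselect (forall v, X v -> v = 0).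
  left; apply/seteqP; split=> [v /X0 //|v ->]; exact: subX.1.
right; apply/seteqP; split=> // w /W_line[d ->].
have [c vE] := W_line _ (XW _ Xv).
have c0 : c != 0 by apply/eqP => c0; apply: v0'; rewrite vE c0 scale0r.
apply: (subspaceZ subX); rewrite -[v0]scale1r -(mulVf c0) -scalerA -vE.
exact: (subspaceZ subX).
Qed.

Lemma whittaker_submodule (K : fieldType) (g : lieAlgType K) (n : lieSub g)
    (V : lieModType g) (lambda : dual n) :
  submodule [set` n] (whittaker lambda : set V).
Proof.
have subW : subspace (whittaker lambda : set V).
  split=> [x|a u v Wu Wv x]; first by rewrite lact0r scaler0.
  by rewrite lact_linr Wu Wv scalerDr !scalerA mulrC.
split=> // x v nx Wv; have -> : lact x v = lambda (LSub nx) *: v.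
  exact: (Wv (LSub nx)).
exact: (subspaceZ subW).
Qed.

Theorem theorem36 (R : realType) (g : lieAlgType R[i])
    (g_countable : countable_dim [set: g])
    (td : triangular g)
    (root_finite : forall alpha : dual (tri_cart td),
       finite_dim (root_space (tri_pos td) alpha))
    (mu : dual (tri_cart td))
    (verma_simple : simple_module [set: g] [set: verma mu])
    (lambda : dual (tri_pos td)) (lambda_char : lie_character lambda) :
  let W : set (completion td (verma mu)) := whittaker lambda in
  has_dim W 1 /\ simple_module [set` tri_pos td] W.
Proof.
move=> W; have char0 : [pchar R[i]] =i pred0 by apply: pchar_num.
have [w0 [w0_neq0 Ww0 W_line]] :=
  whittaker_generator char0 lambda_char root_finite verma_simple.
have subW : submodule [set` tri_pos td] W by apply: whittaker_submodule.
split; first exact: (line_has_dim w0_neq0 Ww0 subW.1 W_line).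
exact: (line_simple w0_neq0 Ww0 subW W_line).
Qed.
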